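(* Let $\mathcal{H}_K$ be an analytic Hilbert space and $\mathcal{E}_*$ be a Hilbert space. Let $\mathcal{S}$ be a non-trivial closed subspace of $\mathcal{H}_K \otimes \mathcal{E}_*$. Then $\mathcal{S}$ is an $(M_z \otimes I_{\mathcal{E}_*})$-invariant subspace of $\mathcal{H}_K \otimes \mathcal{E}_*$ if and only if there exist a Hilbert space $\mathcal{E}$ and a partially isometric multiplier $\Theta \in \mathcal{M}(H^2(\mathbb{D}) \otimes \mathcal{E}, \mathcal{H}_K \otimes \mathcal{E}_* )$ such that \[\mathcal{S} = \Theta\,(H^2(\mathbb{D}) \otimes \mathcal{E}).\]
   Context: All Hilbert spaces are separable and over $\mathbb{C}$. $\mathbb{D}$ is the open unit disc in $\mathbb{C}$. A contraction $T$ on a Hilbert space is a $C_{\cdot 0}$-contraction if $T^{*m} \to 0$ as $m \to \infty$ in the strong operator topology. A non-trivial subspace is one different from $\{0\}$. Let $K : \mathbb{D} \times \mathbb{D} \to \mathbb{C}$ be a positive definite function (in the usual sense for reproducing kernels) which is holomorphic in the first variable and anti-holomorphic in the second, and let $\mathcal{H}_K$ be the reproducing kernel Hilbert space of functions on $\mathbb{D}$ with kernel $K$. $\mathcal{H}_K$ is called an analytic Hilbert space if the operator $M_z$ on $\mathcal{H}_K$, $M_z f = z f$ for $f \in \mathcal{H}_K$, is a (well-defined, bounded) $C_{\cdot 0}$-contraction. The Hardy space $H^2(\mathbb{D})$ is the analytic Hilbert space with the Szegő kernel $\mathbb{S}(z,w) = (1 - z\bar w)^{-1}$. For a Hilbert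 space $\mathcal{E}$, the Hilbert space tensor product $\mathcal{H}_K \otimes \mathcal{E}$ is identified with a space of $\mathcal{E}$-valued functions on $\mathbb{D}$ via $f \otimes \eta \mapsto f(\cdot)\eta$; under this identification $M_z \otimes I_{\mathcal{E}}$ is multiplication by the coordinate function $z$. For analytic Hilbert spaces $\mathcal{H}_{K_1}, \mathcal{H}_{K_2}$ and Hilbert spaces $\mathcal{E}_1, \mathcal{E}_2$, a map $\Theta : \mathbb{D} \to \mathcal{B}(\mathcal{E}_1, \mathcal{E}_2)$ (values in bounded linear operators) is a multiplier from $\mathcal{H}_{K_1} \otimes \mathcal{E}_1$ to $\mathcal{H}_{K_2} \otimes \mathcal{E}_2$ if $\Theta f \in \mathcal{H}_{K_2} \otimes \mathcal{E}_2$ for all $f \in \mathcal{H}_{K_1} \otimes \mathcal{E}_1$, where $(\Theta f)(w) = \Theta(w) f(w)$. The set of all such multipliers is $\mathcal{M}(\mathcal{H}_{K_1} \otimes \mathcal{E}_1, \mathcal{H}_{K_2} \otimes \mathcal{E}_2)$. The associated multiplication operator is $M_\Theta f = \Theta f$; $\Theta$ is partially isometric if $M_\Theta$ is a partial isometry, and $\Theta(H^2(\mathbb{D}) \otimes \mathcal{E})$ denotes the range of $M_\Theta$. *)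

(* Defs.v *)
From HB Require Import structures.
From mathcomp Require Import all_boot all_order all_algebra.
From mathcomp Require Import sesquilinear complex.
From mathcomp Require Import all_classical all_reals all_analysis.

Set Implicit Arguments.
Unset Strict Implicit.
Unset Printing Implicit Defensive.

Import Order.TTheory GRing.Theory Num.Theory.
Import numFieldNormedType.Exports.
Local Open Scope classical_set_scope.
Local Open Scope ring_scope.

(* Separable complex Hilbert spaces; the inner product is linear in its first
   argument, and the norm of a normedModType over R[i] takes its values in the
   nonnegative reals of R[i]. *)
HB.mixin Record CompleteNormedModule_isHilbert (R : realType) V
    & CompleteNormedModule R[i] V := {
  hdot : {dot V for (@Num.conj R[i])} ;
  hdot_norm : forall x : V, hdot x x = `|x| ^+ 2 ;
  hilbert_separable : exists2 A : set V, countable A & dense A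
}.

#[short(type="hilbertType")]
HB.structure Definition Hilbert (R : realType) :=
  {V of CompleteNormedModule R[i] V & CompleteNormedModule_isHilbert R V}.

Definition disc (R : realType) := {z : R[i] | `|z| < 1}.

(* A Hilbert space of E-valued functions on the disc: [fun_of f] is the function
   that the vector f is. *)
HB.mixin Record Hilbert_isFunHilbert (R : realType) (E : normedModType R[i]) V
    & Hilbert R V := {
  fun_of : V -> disc R -> E ;
  fun_of_linear : forall (a : R[i]) (f g : V) (w : disc R),
    fun_of (a *: f + g) w = a *: fun_of f w + fun_of g w ;
  fun_of_inj : injective fun_of ;
  eval_continuous : forall w : disc R, continuous (fun_of ^~ w)
}.

#[short(type="funHilbertType")]
HB.structure Definition FunHilbert (R : realType) (E : normedModType R[i]) :=
  {V of Hilbert R V & Hilbert_isFunHilbert R E V}.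

Section Operators.
Variables (R : realType) (U V : hilbertType R).
Implicit Type A : U -> V.

Definition bounded_linear (U' V' : normedModType R[i]) (A : U' -> V') : Prop :=
  linear A /\ exists M : R[i], forall x, `|A x| <= M * `|x|.

Definition contraction A : Prop :=
  linear A /\ forall x, `|A x| <= `|x|.

(* For bounded linear A, the vector chosen exists by Riesz's theorem and is
   unique. *)
Definition adjoint A (y : V) : U :=
  xget 0 [set x : U | forall u : U, hdot (A u) y = hdot u x].

Definition partial_isometry A : Prop :=
  bounded_linear A /\
  forall x, (forall y, A y = 0 -> hdot x y = 0) -> `|A x| = `|x|.

Definition closed_subspace (S : set U) : Prop :=
  [/\ closed S, S 0 & forall (a : R[i]) x y, S x -> S y -> S (a *: x + y)].

End Operators.

Definition C_dot0_contraction (R : realType) (V : hilbertType R) (T : V -> V)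
    : Prop :=
  contraction T /\
  forall x : V, (fun m : nat => iter m (adjoint T) x) @ \oo --> (0 : V).

Section Multipliers.
Variables (R : realType) (E1 E2 : normedModType R[i]).
Variables (H1 : funHilbertType E1) (H2 : funHilbertType E2).
Implicit Type Theta : disc R -> E1 -> E2.

Definition multiplier Theta : Prop :=
  (forall w, bounded_linear (Theta w)) /\
  forall f : H1, exists g : H2, fun_of g = (fun w => Theta w (fun_of f w)).

(* M_Theta; when Theta is a multiplier the vector chosen exists, and it is
   unique because fun_of is injective. *)
Definition mul_op Theta (f : H1) : H2 :=
  xget 0 [set g : H2 | fun_of g = (fun w => Theta w (fun_of f w))].

End Multipliers.
Arguments multiplier {R E1 E2} H1 H2 Theta.
Arguments mul_op {R E1 E2} H1 H2 Theta f.

Definition coord (R : realType) (E : normedModType R[i]) (w : disc R) (x : E)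
    : E := val w *: x.

(* On a space of E-valued functions of the form H_K (x) E this is M_z (x) I_E. *)
Definition Mz (R : realType) (E : normedModType R[i]) (H : funHilbertType E)
    : H -> H := mul_op H H (@coord R E).

Section Kernels.
Variable R : realType.
Notation C := (R[i]^o).
Implicit Types (K : disc R -> disc R -> R[i]) (H : funHilbertType C).

Definition positive_definite K : Prop :=
  forall (n : nat) (w : 'I_n -> disc R) (c : 'I_n -> R[i]),
    0 <= \sum_(i < n) \sum_(j < n) (c i)^* * c j * K (w i) (w j).

Definition extend0 (f : disc R -> R[i]) (z : C) : C := oapp f 0 (insub z).

(* The disc is open, so the values of the extension off it are irrelevant.
   Derivability over the field R[i] is complex differentiability. *)
Definition holomorphic (f : disc R -> R[i]) : Prop :=
  forall w : disc R, derivable (extend0 f) (val w : C) 1.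

Definition sesqui_holomorphic K : Prop :=
  (forall w, holomorphic (fun z => K z w)) /\
  (forall z, holomorphic (fun w => (K z w)^*)).

Definition is_rkhs K H : Prop :=
  forall w : disc R, exists k : H,
    fun_of k = (fun z => K z w) /\ forall f : H, fun_of f w = hdot f k.

Definition analytic_hilbert K H : Prop :=
  [/\ positive_definite K, sesqui_holomorphic K, is_rkhs K H,
      multiplier H H (@coord R C) & C_dot0_contraction (@Mz R C H)].

Definition szego (z w : disc R) : R[i] := (1 - val z * (val w)^*)^-1.

(* T is the Hilbert space tensor product of H and E, f (x) eta being the function
   f(.)eta: the inner product is the product one on simple tensors, and their
   span (the finite sums, since scalars are absorbed in f) is dense. With the
   continuity of evaluations in T this determines T as a space of functions. *)
Definition is_tensor H (E : hilbertType R) (T : funHilbertType E) : Prop :=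
  exists tens : H -> E -> T,
  [/\ forall f eta, fun_of (tens f eta) = (fun w => fun_of f w *: eta),
      forall f g eta xi,
        hdot (tens f eta) (tens g xi) = hdot f g * hdot eta xi
    & dense [set F : T | exists (n : nat) (f : 'I_n -> H) (eta : 'I_n -> E),
                           F = \sum_(i < n) tens (f i) (eta i)]].

End Kernels.

(* Main.v *)
(* Write T for M_z on H_K (x) E_*, T' for its adjoint and P for the
   projection onto S. If S is invariant then |P T' x| <= |P x|, so <P x, P
   y> - <P T' x, P T' y> is a positive form and equals <D x, D y> for some
   linear D into a Hilbert space E. As T'^m -> 0, the map x |-> (D T'^m x)_m
   into H^2 (x) E has |image of x| = |P x|, and it intertwines T' with the
   backward shift. Its adjoint W is therefore a partial isometry with range
   S that intertwines the shift with T, which forces W to be multiplication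
   by Theta(w) eta = (W (1 (x) eta))(w).

   Conversely z k_w = (k_w - k_0) / w^* for the Szego kernel k_w with w <>
   0, so T maps Theta (k_w (x) eta) into the range of Theta, and the k_w (x)
   eta are total.

   No square root of an operator is needed: positive forms are factored by
   Cholesky elimination along a dense sequence. The same factorisation
   yields Schur's product theorem, hence the contractivity of M_z (x) I. *)
Require Import Defs.
From HB Require Import structures.
From mathcomp Require Import all_boot all_order all_algebra.
From mathcomp Require Import sesquilinear complex.
From mathcomp Require Import all_classical all_reals all_analysis.
From mathcomp Require Import ring lra.

Set Implicit Arguments.
Unset Strict Implicit.
Unset Printing Implicit Defensive.

Import Order.TTheory GRing.Theory Num.Theory.
Import numFieldNormedType.Exports.
Local Open Scope classical_set_scope.
Local Open Scope ring_scope.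

(** * Positive semidefinite forms *)

Section PsdForms.
Variable C : numClosedFieldType.

(** In the direct half the model of [H^2 (x) E] can be chosen, and [l2 E] is taken, where the
    backward shift and the monomials are explicit. The coefficient space is always [l2] over the
    complex line, however small the rank of the defect form: the adjoint of the dilation kills
    whatever is orthogonal to the range of the dilation. In the converse half the Hardy space is an
    arbitrary space with the Szego kernel, so only its kernel functions are at hand; the identity
    for z k_w is useful because it stays within their span.

    The hypotheses on M_z concern H_K alone, while the argument runs in the tensor product. A bound
    on simple tensors does not by itself bound their sums, and this is the gap that Schur's theorem
    closes.

    Positive forms are set on bare modules because the residuals of the elimination are degenerate
    and partial sums are formed on sequences before any norm exists. *)

Record psd_form (V : lmodType C) (q : V -> V -> C) : Prop := PsdForm {
  psd_linear : forall a x y z, q (a *: x + y) z = a * q x z + q y z ;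
  psd_herm : forall x y, q x y = (q y x)^* ;
  psd_ge0 : forall x, 0 <= q x x }.

Variables (V : lmodType C) (q : V -> V -> C).
Hypothesis qP : psd_form q.

Lemma psd0l z : q 0 z = 0.
Proof.
have := psd_linear qP (-1) 0 0 z.
by rewrite scaler0 addr0 mulN1r addNr.
Qed.

Lemma psdDl x y z : q (x + y) z = q x z + q y z.
Proof. by rewrite -[x]scale1r (psd_linear qP) scale1r mul1r. Qed.

Lemma psdZl a x z : q (a *: x) z = a * q x z.
Proof. by rewrite -[a *: x]addr0 (psd_linear qP) psd0l addr0. Qed.

Lemma psdBl x y z : q (x - y) z = q x z - q y z.
Proof. by rewrite -scaleN1r psdDl psdZl mulN1r. Qed.

Lemma psd0r z : q z 0 = 0.
Proof. by rewrite (psd_herm qP) psd0l conjC0. Qed.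

Lemma psdDr x y z : q z (x + y) = q z x + q z y.
Proof. by rewrite (psd_herm qP) psdDl rmorphD /= -!(psd_herm qP). Qed.

Lemma psdZr a x z : q z (a *: x) = a^* * q z x.
Proof. by rewrite (psd_herm qP) psdZl rmorphM /= -(psd_herm qP). Qed.

Lemma psdBr x y z : q z (x - y) = q z x - q z y.
Proof. by rewrite (psd_herm qP) psdBl rmorphB /= -!(psd_herm qP). Qed.

Lemma psd_suml I (r : seq I) (F : I -> V) z :
  q (\sum_(i <- r) F i) z = \sum_(i <- r) q (F i) z.
Proof. exact: (big_morph (q^~ z) (fun x y => psdDl x y z) (psd0l z)). Qed.

Lemma psd_sumr I (r : seq I) (F : I -> V) z :
  q z (\sum_(i <- r) F i) = \sum_(i <- r) q z (F i).
Proof. exact: (big_morph (q z) (fun x y => psdDr x y z) (psd0r z)). Qed.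

Lemma psd_subZ x y t :
  q (x - t *: y) (x - t *: y) =
  q x x - t^* * q x y - t * (q x y)^* + `|t| ^+ 2 * q y y.
Proof.
rewrite psdBl !psdBr psdZl !psdZr psdZl (psd_herm qP y x) normCK; ring.
Qed.

(** Along a null direction [y] the value of [q] at x - t y has no quadratic term in t, so a nonzero
    [q x y] would drive it below zero. *)
Lemma psd_null x y : q y y = 0 -> q x y = 0.
Proof.
move=> qy0; apply/eqP/negPn/negP => c0.
set c := q x y in c0.
have cc0 : `|c| ^+ 2 != 0 by rewrite expf_eq0 /= normr_eq0.
(* Chosen so that 2 s |c|^2 = q x x + 1, which makes the value at x - s c y equal to -1. *)
pose s := (q x x + 1) / (2 * `|c| ^+ 2).
have s_conj : s^* = s.
  apply: CrealP; rewrite realE; apply/orP; left.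
  rewrite divr_ge0 ?mulr_ge0 ?exprn_ge0 ?addr_ge0 ?ler01 ?ler0n //.
  exact: psd_ge0.
have := psd_ge0 qP (x - (s * c) *: y).
rewrite psd_subZ qy0 mulr0 addr0 -/c rmorphM /= s_conj.
have -> : q x x - s * c^* * c - s * c * c^* = -1.
  have -> : q x x - s * c^* * c - s * c * c^* = q x x - s * (2 * (c * c^*)).
    ring.
  rewrite -normCK /s divfK; first by ring.
  by rewrite mulf_neq0 ?pnatr_eq0.
by rewrite oppr_ge0 ler10.
Qed.

(** The Schur complement of [q] along [e]. When [q e e = 0] the division gives 0 and the form is
    unchanged, as it should be since [e] is then already null. *)
Definition residual (e x y : V) : C := q x y - q x e * (q y e)^* / q e e.

Lemma residual_psd e : psd_form (residual e).
Proof.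
split=> [a x y z|x y|x].
- by rewrite /residual !(psd_linear qP); ring.
- rewrite /residual rmorphB /= rmorphM fmorphV /= rmorphM /= conjCK.
  by rewrite -(psd_herm qP x y) -(psd_herm qP e e); ring.
- rewrite /residual.
  have [qe0|qe0] := eqVneq (q e e) 0.
    by rewrite qe0 invr0 mulr0 subr0 (psd_ge0 qP).
  have := psd_ge0 qP (x - (q x e / q e e) *: e).
  rewrite psd_subZ (_ : _ + _ = q x x - q x e * (q x e)^* / q e e) //.
  rewrite normCK rmorphM fmorphV /= -(psd_herm qP e e); by field.
Qed.

Lemma residual_le e x : residual e x x <= q x x.
Proof.
by rewrite gerBl mulr_ge0 ?invr_ge0 ?(psd_ge0 qP) // -normCK exprn_ge0.
Qed.

Lemma residual_null e x : q x x = 0 -> residual e x x = 0.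
Proof.
move=> qx0; apply/eqP; rewrite eq_le (psd_ge0 (residual_psd e)) andbT.
by rewrite -qx0 residual_le.
Qed.

Lemma residual_self e : residual e e e = 0.
Proof.
rewrite /residual -(psd_herm qP).
by have [->|q0] := eqVneq (q e e) 0; rewrite ?mul0r ?subr0 // mulfK // subrr.
Qed.

Lemma psd_CauchySchwarz x y : `|q x y| ^+ 2 <= q x x * q y y.
Proof.
have [qy0|qy0] := eqVneq (q y y) 0.
  by rewrite (psd_null x qy0) normr0 expr0n /= mulr_ge0 ?(psd_ge0 qP).
have := psd_ge0 (residual_psd y) x.
have qy_gt0 : 0 < q y y by rewrite lt_def qy0 (psd_ge0 qP).
by rewrite /residual subr_ge0 -normCK ler_pdivrMr.
Qed.

End PsdForms.

(* Cholesky factorisation along a sequence e: each step subtracts from the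
   form a rank-one term that makes e_n null, and null vectors stay null. *)
Section Cholesky.
Variables (C : numClosedFieldType) (V : lmodType C) (q : V -> V -> C).
Hypothesis qP : psd_form q.
Variable e : nat -> V.

Fixpoint residuals (n : nat) : V -> V -> C :=
  if n is m.+1 then residual (residuals m) (e m) else q.

Lemma residuals_psd n : psd_form (residuals n).
Proof. by elim: n => //= n IH; exact: residual_psd. Qed.

Lemma residuals_le n x : residuals n x x <= q x x.
Proof.
elim: n => //= n; apply: le_trans; exact: residual_le (residuals_psd n) _ _.
Qed.

Lemma residuals_null n k : (k < n)%N -> residuals n (e k) (e k) = 0.
Proof.
elim: n => // n IH; rewrite ltnS leq_eqVlt => /orP[/eqP ->|/IH H] /=.
  exact: residual_self (residuals_psd n) _.
exact: residual_null (residuals_psd n) _ _ H.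
Qed.

Definition cholesky (n : nat) (x : V) : C :=
  residuals n x (e n) / sqrtC (residuals n (e n) (e n)).

Lemma cholesky_linear n a x y :
  cholesky n (a *: x + y) = a * cholesky n x + cholesky n y.
Proof. by rewrite /cholesky (psd_linear (residuals_psd n)); ring. Qed.

(** Each elimination step subtracts exactly the product of two Cholesky coefficients, so the sum
    telescopes; a zero pivot contributes 0 on both sides. *)
Lemma cholesky_sum n x y :
  \sum_(i < n) cholesky i x * (cholesky i y)^* = q x y - residuals n x y.
Proof.
elim: n => [|n IH]; first by rewrite big_ord0 subrr.
rewrite big_ord_recr /= IH /residual /cholesky opprB -!addrA; congr (_ + _).
rewrite addrC; congr (_ - _).
set b := residuals n (e n) (e n).
have b0 : 0 <= b := psd_ge0 (residuals_psd n) _.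
rewrite rmorphM fmorphV /= (@geC0_conj _ (sqrtC b)) ?sqrtC_ge0 //.
by rewrite -{3}[b]sqrtCK expr2 invfM; ring.
Qed.

End Cholesky.

(** * Limits and bounded linear maps in normed modules *)

Section NormedModules.
Variable K : numFieldType.
Implicit Types U V : normedModType K.

Lemma closed_approx V (S : set V) (x : V) : closed S ->
  (forall e : K, 0 < e -> exists2 y, S y & `|x - y| < e) -> S x.
Proof.
move=> Scl H; apply: Scl => B /nbhs_normP[e /= e0 eB].
by have [y Sy xy] := H e e0; exists y; split => //; exact: eB.
Qed.

Lemma dense_approx V (A : set V) :
  dense A <-> forall (x : V) (e : K), 0 < e -> exists2 y, A y & `|x - y| < e.
Proof.
split=> [dA x e e0|H O [x Ox] oO].
  have [|y [By Ay]] := dA (ball x e) _ (ball_open x e).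
    by exists x; exact: ballxx.
  by exists y => //; move: By; rewrite -ball_normE.
have /nbhs_normP[e /= e0 eO] : nbhs x O by exact: open_nbhs_nbhs.
by have [y Ay xy] := H x e e0; exists y; split => //; exact: eO.
Qed.

(** The order of [K] may be partial, so the limit is compared with that of [|f|]: the two functions
    agree eventually, hence [l = |l|]. *)
Lemma cvg_ge0 T (F : set_system T) (FF : ProperFilter F) (f : T -> K) (l : K) :
  (\forall t \near F, 0 <= f t) -> f @ F --> l -> 0 <= l.
Proof.
move=> f0 fl.
have fn : (fun t => `|f t|) @ F --> `|l| by exact: cvg_norm.
suff -> : l = `|l| by [].
apply: (@norm_cvg_unique _ _ (f @ F)); first by exact: fl.
apply: cvg_trans fn; apply: near_eq_cvg.
by apply: filterS f0 => t /ger0_norm.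
Qed.

Lemma cvg_le_const T (F : set_system T) (FF : ProperFilter F) (f : T -> K)
    (l M : K) :
  (\forall t \near F, f t <= M) -> f @ F --> l -> l <= M.
Proof.
move=> fM fl; rewrite -subr_ge0; apply: (@cvg_ge0 _ F _ (fun t => M - f t)).
  by apply: filterS fM => t; rewrite subr_ge0.
by apply: cvgB => //; exact: cvg_cst.
Qed.

Lemma cvg_ge_const T (F : set_system T) (FF : ProperFilter F) (f : T -> K)
    (l M : K) :
  f @ F --> l -> (\forall t \near F, M <= f t) -> M <= l.
Proof.
move=> fl fM; rewrite -subr_ge0; apply: (@cvg_ge0 _ F _ (fun t => f t - M)).
  by apply: filterS fM => t; rewrite subr_ge0.
by apply: cvgB => //; exact: cvg_cst.
Qed.

Lemma seq_complete (V : completeNormedModType K) (y : nat -> V) :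
  (forall e : K, 0 < e -> exists N : nat, forall n, (N <= n)%N ->
     `|y N - y n| < e) ->
  exists l : V, y @ \oo --> l.
Proof.
move=> H; exists (lim (y @ \oo)); apply: cauchy_cvg; apply: cauchy_exP => e e0.
have [N HN] := H e e0; exists (y N).
by exists N => // n /= /HN; rewrite -ball_normE.
Qed.

Lemma lin0 U V (A : U -> V) : linear A -> A 0 = 0.
Proof.
move=> lA; have := lA (-1) 0 0.
by rewrite scaler0 addr0 scaleN1r addNr.
Qed.

Lemma linD U V (A : U -> V) x y : linear A -> A (x + y) = A x + A y.
Proof. by move=> lA; rewrite -{1}[x]scale1r lA scale1r. Qed.

Lemma linZ U V (A : U -> V) a x : linear A -> A (a *: x) = a *: A x.
Proof. by move=> lA; rewrite -[a *: x]addr0 lA (lin0 lA) addr0. Qed.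

Lemma linB U V (A : U -> V) x y : linear A -> A (x - y) = A x - A y.
Proof. by move=> lA; rewrite -scaleN1r linD // linZ // scaleN1r. Qed.

Lemma lin_sum U V (A : U -> V) I (r : seq I) (F : I -> U) : linear A ->
  A (\sum_(i <- r) F i) = \sum_(i <- r) A (F i).
Proof.
by move=> lA; apply: (big_morph A) => [x y|]; rewrite ?(lin0 lA) ?linD.
Qed.

End NormedModules.

Section BoundedLinear.
Variable R : realType.
Implicit Types U V W : normedModType R[i].

(** On a zero space any [M] is a bound, even a non-real one; hence the passage to [|M| + 1]. *)
Lemma bounded_linear_ge0 U V (A : U -> V) : bounded_linear A ->
  exists2 M : R[i], 0 < M & forall x, `|A x| <= M * `|x|.
Proof.
move=> [_ [M HM]]; exists (`|M| + 1) => [|x]; first by rewrite ltr_wpDl.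
apply: (le_trans (HM x)).
rewrite -[leLHS]ger0_norm ?(le_trans _ (HM x)) // normrM normr_id.
by rewrite ler_wpM2r // lerDl.
Qed.

Lemma bounded_linear_is_continuous U V (A : U -> V) :
  bounded_linear A -> continuous A.
Proof.
move=> bA x; have [M M0 HM] := bounded_linear_ge0 bA.
apply/cvgrPdist_lt => e e0; near=> y.
rewrite -(linB _ _ (proj1 bA)); apply: (le_lt_trans (HM _)).
rewrite mulrC -ltr_pdivlMr //; near: y.
by apply: cvgr_dist_lt; [exact: cvg_id|rewrite divr_gt0].
Unshelve. all: by end_near. Qed.

Lemma continuous_bounded_linear U V (A : U -> V) :
  linear A -> continuous A -> bounded_linear A.
Proof.
move=> lA cA; split=> //.
have /cvgrPdist_lt/(_ 1 ltr01) := cA 0.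
rewrite lin0 // => /nbhs_normP[d /= d0 H].
(* A nonzero vector is rescaled to length d / 2, inside the ball on which [A] has norm below 1. *)
exists (2 / d) => x; have [->|x0] := eqVneq x 0.
  by rewrite lin0 // !normr0 mulr0.
have nx : 0 < `|x| by rewrite normr_gt0.
have t0 : 0 < d / 2 / `|x| by rewrite !divr_gt0.
have := H ((d / 2 / `|x|) *: x).
rewrite /ball_ /= !sub0r !normrN linZ // !normrZ.
rewrite (gtr0_norm t0) divfK ?gt_eqF // ltr_pdivrMr // ltr_pMr // ltr1n.
move=> /(_ isT) /ltW; rewrite mulrC -ler_pdivlMr // => /le_trans; apply.
by rewrite div1r invf_div mulrC invf_div mulrC.
Qed.

Lemma bounded_linear_comp U V W (A : U -> V) (B : V -> W) :
  bounded_linear A -> bounded_linear B -> bounded_linear (B \o A).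
Proof.
move=> bA bB; apply: continuous_bounded_linear => [a x y|x].
  by rewrite /= (proj1 bA) (proj1 bB).
by apply: continuous_comp; exact: bounded_linear_is_continuous.
Qed.

End BoundedLinear.

(** * Projections, Riesz representation and adjoints *)

Section HilbertSpaces.
Variable R : realType.
Implicit Types U V : hilbertType R.

Lemma pos_complexP (e : R[i]) : 0 < e -> exists2 r : R, 0 < r & e = r%:C%C.
Proof.
move=> e0; have e_re : e = (complex.Re e)%:C%C by rewrite RRe_real // realE ltW.
by exists (complex.Re e) => //; move: e0; rewrite {1}e_re ltcR.
Qed.

Lemma invn_small (e : R[i]) : 0 < e -> exists n : nat, n.+1%:R^-1 < e.
Proof.
move=> /pos_complexP[r r0 ->].
have [n] := ltr_add_invr r0; rewrite add0r => nr; exists n.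
by rewrite -(rmorph_nat (real_complex R)) -fmorphV ltcR.
Qed.

Lemma hdot_psd V : psd_form (@hdot R V).
Proof.
split=> [a x y z|x y|x].
- by rewrite linearDl linearZl_LR.
- by rewrite hermC expr0 mul1r.
- by rewrite hdot_norm exprn_ge0.
Qed.

Lemma hdot_CauchySchwarz V (x y : V) : `|hdot x y| <= `|x| * `|y|.
Proof.
rewrite -(@ler_pXn2r _ 2) ?nnegrE ?mulr_ge0 //.
rewrite exprMn -!hdot_norm; exact: psd_CauchySchwarz (hdot_psd V) _ _.
Qed.

Lemma hdotC V (x y : V) : hdot x y = (hdot y x)^*.
Proof. exact: psd_herm (hdot_psd V) _ _. Qed.

Lemma hdot_bounded V (z : V) : bounded_linear ((hdot^~ z) : V -> R[i]^o).
Proof.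
split=> [a x y|]; first exact: psd_linear (hdot_psd V) _ _ _ _.
by exists `|z| => x; rewrite mulrC; exact: hdot_CauchySchwarz.
Qed.

Lemma hdot_eq0 V (x : V) : (forall y, hdot x y = 0) -> x = 0.
Proof.
by move=> /(_ x) /eqP; rewrite hdot_norm expf_eq0 /= normr_eq0 => /eqP.
Qed.

Lemma hdot_inj V (x x' : V) : (forall y, hdot y x = hdot y x') -> x = x'.
Proof.
move=> H; apply/eqP; rewrite -subr_eq0; apply/eqP/hdot_eq0 => y.
by rewrite hdotC (psdBr (hdot_psd V)) H subrr conjC0.
Qed.

Lemma parallelogram V (x y : V) :
  `|x - y| ^+ 2 = 2 * `|x| ^+ 2 + 2 * `|y| ^+ 2 - `|x + y| ^+ 2.
Proof.
have qP := hdot_psd V.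
rewrite -!hdot_norm (psdBl qP) !(psdBr qP) (psdDl qP) !(psdDr qP); ring.
Qed.

Lemma minimal_orthogonal V (u y : V) :
  (forall t : R[i], `|u| <= `|u - t *: y|) -> hdot u y = 0.
Proof.
move=> H; have qP := hdot_psd V.
have [->|y0] := eqVneq y 0; first exact: psd0r.
have yy0 : 0 < `|y| ^+ 2 by rewrite exprn_gt0 ?normr_gt0.
(* This t minimises the distance from [u] to the line of [y]; the squared norm drops by |c|^2 /
   |y|^2, so minimality forces c = 0. *)
set c := hdot u y; pose t := c / `|y| ^+ 2.
have : `|u| ^+ 2 <= `|u - t *: y| ^+ 2 by rewrite ler_pXn2r ?nnegrE.
rewrite -!hdot_norm (psd_subZ qP) -/c hdot_norm.
have tE : t^* = c^* / `|y| ^+ 2.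
  by rewrite /t rmorphM fmorphV /= rmorphXn /= (geC0_conj (normr_ge0 y)).
rewrite -subr_ge0 (_ : _ - _ = - (`|c| ^+ 2 / `|y| ^+ 2)); last first.
  rewrite [`|t| ^+ 2]normCK [`|c| ^+ 2]normCK tE /t.
  by rewrite hdot_norm; field; rewrite normr_eq0.
rewrite oppr_ge0 pmulr_lle0 ?invr_gt0 // => c0.
have : `|c| ^+ 2 == 0 by rewrite eq_le c0 exprn_ge0.
by rewrite expf_eq0 normr_eq0 => /eqP.
Qed.

Lemma projection V (S : set V) (x : V) : closed_subspace S ->
  exists2 p, S p & forall y, S y -> hdot (x - p) y = 0.
Proof.
move=> [Scl S0 Slin].
(* Squared distances are moved to [R], where infima exist. *)
pose N (y : V) : R := complex.Re (`|x - y| ^+ 2).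
have NE y : `|x - y| ^+ 2 = (N y)%:C%C.
  by rewrite RRe_real // rpredX ?normr_real.
have N0 y : 0 <= N y by rewrite -lecR -NE exprn_ge0.
have hinf : has_inf (N @` S).
  by split; [exists (N 0), 0|exists 0 => _ [y _ <-]].
set d := inf (N @` S).
have dN y : S y -> d <= N y by move=> Sy; apply: ge_inf; [case: hinf|exists y].
have /choice[y Hy] (n : nat) : exists y, S y /\ N y < d + n.+1%:R^-1.
  have n0 : 0 < n.+1%:R^-1 :> R by rewrite invr_gt0.
  have [_ [y Sy <-] lt] := inf_adherent n0 hinf.
  by exists y.
have Sy n : S (y n) := proj1 (Hy n).
(* The midpoint of [y m] and [y n] lies in [S], so its squared distance to [x] is at least d; the
   parallelogram law then makes the minimising sequence Cauchy. *)
have yd m n : `|y m - y n| ^+ 2 <= (2 * m.+1%:R^-1 + 2 * n.+1%:R^-1)%:C%C.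
  have -> : y m - y n = (x - y n) - (x - y m).
    by rewrite opprB [RHS]addrC addrA subrK.
  rewrite parallelogram.
  set z := 2^-1 *: (y m + y n).
  have Sz : S z.
    rewrite /z -[_ *: _]addr0; apply: (Slin) => //.
    by rewrite -[y m]scale1r; apply: Slin.
  have -> : x - y n + (x - y m) = 2 *: (x - z).
    by rewrite /z scalerBr scalerA divff ?pnatr_eq0 // scale1r scaler_nat mulr2n
      opprD addrACA [- _ - _]addrC.
  rewrite normrZ exprMn normr_nat !NE.
  rewrite -(rmorph_nat (real_complex R) 2) -rmorphXn -!rmorphM.
  rewrite -rmorphD -rmorphB lecR /=.
  have := dN _ Sz; have := proj2 (Hy m); have := proj2 (Hy n).
  move: (N _) (N _) (N _) (_^-1) (_^-1) => a b c e f; lra.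
have [p yp] : exists p : V, y @ \oo --> p.
  apply: seq_complete => e e0.
  have [k Hk] : exists k : nat, k.+1%:R^-1 < e ^+ 2 / 4.
    by apply: invn_small; rewrite divr_gt0 ?exprn_gt0.
  exists k => n kn; rewrite -(@ltr_pXn2r _ 2) ?nnegrE ?normr_ge0 ?(ltW e0) //.
  apply: le_lt_trans (yd _ _) _.
  apply: (@le_lt_trans _ _ (4 * k.+1%:R^-1)); last first.
    by rewrite mulrC -ltr_pdivlMr.
  rewrite -(rmorph_nat (real_complex R) 4) -(rmorph_nat (real_complex R) k.+1).
  rewrite -fmorphV -rmorphM lecR /=.
  have : n.+1%:R^-1 <= k.+1%:R^-1 :> R by rewrite lef_pV2 ?posrE // ler_nat.
  move: (n.+1%:R^-1) (k.+1%:R^-1) => a b; lra.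
have Sp : S p.
  apply: closed_approx => // e e0.
  have /cvgrPdist_lt/(_ e e0)[k _ /(_ k (leqnn k)) Hk] := yp.
  by exists (y k).
exists p => // z Sz; apply: minimal_orthogonal => t.
rewrite -(@ler_pXn2r _ 2) ?nnegrE //.
rewrite (_ : x - p - t *: z = x - (t *: z + p)); last first.
  by rewrite opprD addrA addrAC.
rewrite [leRHS]NE; have {}Sz : S (t *: z + p) by exact: Slin.
rewrite NE lecR; apply: le_trans (dN _ Sz).
rewrite leNgt; apply/negP => /ltr_add_invr[k].
apply/negP; rewrite -leNgt -lecR -NE.
apply: (@cvg_le_const _ _ \oo _ (fun n => `|x - y n| ^+ 2)).
  exists k => // n /= kn; rewrite NE lecR.
  apply: (le_trans (ltW (proj2 (Hy n)))).
  by rewrite lerD2l lef_pV2 ?posrE // ler_nat.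
have cn : (fun n => `|x - y n|) @ \oo --> `|x - p|.
  by apply: cvg_norm; apply: cvgB => //; exact: cvg_cst.
rewrite expr2; under eq_fun do rewrite expr2.
exact: cvgM.
Qed.
End HilbertSpaces.

Section Adjoints.
Variable R : realType.
Implicit Types U V : hilbertType R.

Lemma closed_ker (U V : normedModType R[i]) (A : U -> V) :
  bounded_linear A -> closed [set u | A u = 0].
Proof.
move=> bA; have cA := @bounded_linear_is_continuous _ _ _ _ bA.
rewrite (_ : [set _ | _] = A @^-1` [set 0]) //.
apply: closed_comp => [x _|]; first exact: cA.
apply: accessible_closed_set1; apply: hausdorff_accessible.
exact: norm_hausdorff.
Qed.

Lemma closed_subspace_eq U (V : normedModType R[i]) (A B : U -> V) :
  bounded_linear A -> bounded_linear B -> closed_subspace [set u | A u = B u].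
Proof.
move=> bA bB; have [lA lB] := (proj1 bA, proj1 bB).
have bAB : bounded_linear (fun u => A u - B u).
  split=> [a x y|]; first by rewrite lA lB opprD addrACA scalerBr.
  have [M _ HM] := bounded_linear_ge0 bA.
  have [N _ HN] := bounded_linear_ge0 bB.
  exists (M + N) => x; rewrite (le_trans (ler_normB _ _)) // mulrDl.
  by rewrite lerD.
split=> [||a x y Sx Sy] /=.
- rewrite (_ : [set _ | _] = [set u | A u - B u = 0]); first exact: closed_ker.
  apply/seteqP; split=> u /= => [->|/eqP]; first by rewrite subrr.
  by rewrite subr_eq0 => /eqP.
- by rewrite !lin0.
- by rewrite lA lB Sx Sy.
Qed.

Lemma closed_subspace_preimage U V (A : U -> V) (S : set V) :
  bounded_linear A -> closed_subspace S -> closed_subspace (A @^-1` S).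
Proof.
move=> bA [Scl S0 Slin]; have cA := @bounded_linear_is_continuous _ _ _ _ bA.
split.
- by apply: closed_comp => // x _; exact: cA.
- by rewrite /preimage /= (lin0 (proj1 bA)).
- by move=> a x y Sx Sy; rewrite /preimage /= (proj1 bA); exact: Slin.
Qed.

(** Take [w] orthogonal to the kernel. As u - (phi u / phi w) w lies in the kernel, a multiple of
    [w] represents [phi]; the factor is conjugated because [hdot] is antilinear on the right. *)
Lemma riesz U (phi : U -> R[i]^o) :
  bounded_linear phi -> exists z, forall u, phi u = hdot u z.
Proof.
move=> bphi; have lphi := proj1 bphi; have qP := hdot_psd U.
pose S := [set u | phi u = 0].
have sS : closed_subspace S.
  split=> [||a x y Sx Sy]; first exact: closed_ker.
    exact: lin0.
  by rewrite /S /= lphi Sx Sy scaler0 addr0.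
have [phi0|/existsNP[x x0]] := pselect (forall u, phi u = 0).
  by exists 0 => u; rewrite phi0 (psd0r qP).
have [p Sp Hp] := projection x sS.
pose w := x - p.
have w0 : phi w != 0 by rewrite /w linB // Sp subr0; exact/eqP.
have ww0 : hdot w w != 0.
  rewrite hdot_norm expf_eq0 normr_eq0 /=; apply: contra w0 => /eqP ->.
  by rewrite lin0.
exists ((phi w / hdot w w)^* *: w) => u.
rewrite (psdZr qP) conjCK.
have : hdot w (u - (phi u / phi w) *: w) = 0.
  by apply: Hp; rewrite /S /= linB // linZ // /GRing.scale /= divfK // subrr.
move=> /(congr1 Num.conj); rewrite conjC0 -hdotC (psdBl qP) (psdZl qP).
move=> /eqP; rewrite subr_eq0 => /eqP ->.
by field; rewrite w0 ww0.
Qed.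

Lemma adjointP U V (A : U -> V) : bounded_linear A ->
  forall u y, hdot (A u) y = hdot u (adjoint A y).
Proof.
move=> bA u y.
have bAy : bounded_linear ((fun u => hdot (A u) y) : U -> R[i]^o).
  exact: bounded_linear_comp bA (hdot_bounded y).
have [z Hz] := riesz bAy.
exact: (@xgetPex _ 0 [set x | forall u, hdot (A u) y = hdot u x]
  (ex_intro _ z Hz)).
Qed.

Lemma adjoint_unique U V (A : U -> V) x y : bounded_linear A ->
  (forall u, hdot (A u) y = hdot u x) -> adjoint A y = x.
Proof. by move=> bA H; apply: hdot_inj => u; rewrite -adjointP. Qed.

Lemma adjoint_linear U V (A : U -> V) : bounded_linear A -> linear (adjoint A).
Proof.
move=> bA a x y; apply: adjoint_unique => // u.
have [qU qV] := (hdot_psd U, hdot_psd V).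
by rewrite (psdDr qV) (psdZr qV) !adjointP // (psdDr qU) (psdZr qU).
Qed.

Lemma adjoint_le U V (A : U -> V) (M : R[i]) : linear A -> 0 <= M ->
  (forall x, `|A x| <= M * `|x|) -> forall y, `|adjoint A y| <= M * `|y|.
Proof.
move=> lA M0 HM y; set z := adjoint A y.
have bA : bounded_linear A by split; last by exists M.
have [->|z0] := eqVneq z 0; first by rewrite normr0 mulr_ge0.
have nz : 0 < `|z| by rewrite normr_gt0.
rewrite -(ler_pM2r nz) -expr2 -hdot_norm {2}/z -adjointP //.
rewrite -[leLHS]ger0_norm; last first.
  by rewrite adjointP // -/z hdot_norm exprn_ge0.
by apply: le_trans (hdot_CauchySchwarz _ _) _; rewrite mulrAC ler_wpM2r.
Qed.

Lemma adjoint_bounded U V (A : U -> V) : bounded_linear A ->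
  bounded_linear (adjoint A).
Proof.
move=> bA; split; first exact: adjoint_linear.
have [M M0 HM] := bounded_linear_ge0 bA.
by exists M; apply: adjoint_le => //; [exact: proj1 bA|exact: ltW].
Qed.

Lemma contraction_bounded U V (A : U -> V) :
  Defs.contraction A -> bounded_linear A.
Proof. by case=> lA HA; split=> //; exists 1 => x; rewrite mul1r. Qed.

Lemma contraction_adjoint U V (A : U -> V) :
  Defs.contraction A -> Defs.contraction (adjoint A).
Proof.
move=> cA; split; first exact/adjoint_linear/contraction_bounded.
move=> y; rewrite -[leRHS]mul1r; apply: adjoint_le => // [|x].
  by case: cA.
by rewrite mul1r; case: cA.
Qed.

End Adjoints.

Section OrthogonalProjection.
Variables (R : realType) (V : hilbertType R) (S : set V).
Hypothesis sS : closed_subspace S.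

Definition orthproj (x : V) : V :=
  xget 0 [set p | S p /\ forall y, S y -> hdot (x - p) y = 0].

Let qP := hdot_psd V.

Lemma orthproj_spec x :
  S (orthproj x) /\ forall y, S y -> hdot (x - orthproj x) y = 0.
Proof.
have [p Sp Hp] := projection x sS.
exact: (@xgetPex _ 0 [set p | S p /\ forall y, S y -> hdot (x - p) y = 0]
  (ex_intro _ p (conj Sp Hp))).
Qed.

Lemma orthproj_in x : S (orthproj x).
Proof. by case: (orthproj_spec x). Qed.

Lemma orthproj_hdot x y : S y -> hdot (orthproj x) y = hdot x y.
Proof.
case: (orthproj_spec x) => _ H /H /eqP.
by rewrite (psdBl qP) subr_eq0 => /eqP.
Qed.

Lemma orthproj_unique x p :
  S p -> (forall y, S y -> hdot p y = hdot x y) -> orthproj x = p.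
Proof.
move=> Sp H; apply/eqP; rewrite -subr_eq0; apply/eqP.
have Sd : S (orthproj x - p).
  rewrite -scaleN1r addrC.
  by case: sS => _ _; apply=> //; exact: orthproj_in.
apply/eqP; rewrite -normr_eq0 -sqrf_eq0 -hdot_norm (psdBl qP).
by rewrite orthproj_hdot // H // subrr.
Qed.

Lemma orthproj_id x : S x -> orthproj x = x.
Proof. by move=> Sx; apply: orthproj_unique. Qed.

Lemma orthproj_linear : linear orthproj.
Proof.
move=> a x y; apply: orthproj_unique => [|z Sz].
  by case: sS => _ _; apply; exact: orthproj_in.
by rewrite !(psd_linear qP) !orthproj_hdot.
Qed.

Lemma orthproj_contraction : Defs.contraction orthproj.
Proof.
split=> [|x]; first exact: orthproj_linear.
set p := orthproj x.
have [->|p0] := eqVneq p 0; first by rewrite normr0.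
have np : 0 < `|p| by rewrite normr_gt0.
rewrite -(ler_pM2r np) -expr2 -hdot_norm {1}/p orthproj_hdot; last first.
  exact: orthproj_in.
rewrite -[leLHS]ger0_norm; first exact: hdot_CauchySchwarz.
by rewrite -orthproj_hdot ?hdot_norm ?exprn_ge0 //; exact: orthproj_in.
Qed.

Lemma closed_subspace_full :
  (forall f : V, (forall x, S x -> hdot f x = 0) -> f = 0) -> forall x, S x.
Proof.
move=> H x; have /eqP : x - orthproj x = 0 by apply: H; case: (orthproj_spec x).
by rewrite subr_eq0 => /eqP ->; exact: orthproj_in.
Qed.

End OrthogonalProjection.

(** * Square-summable sequences *)

Section DotOfPsdForm.
Variables (C : numClosedFieldType) (V : lmodType C) (q : V -> V -> C).
Hypotheses (qP : psd_form q) (q_definite : forall x, x != 0 -> q x x != 0).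

Lemma psd_bilinear : bilinear_for *%R (Num.conj \; *%R) q.
Proof.
split=> [z a x y|z a x y] /=; first exact: psd_linear.
by rewrite (psdDr qP) (psdZr qP).
Qed.

Lemma psd_hermitian x y : q x y = (-1) ^+ false * (q y x)^*.
Proof. by rewrite expr0 mul1r (psd_herm qP). Qed.

Lemma psd_positive x : x != 0 -> 0 < q x x.
Proof. by move=> x0; rewrite lt_def q_definite // (psd_ge0 qP). Qed.

Definition psd_dot : {dot V for (@Num.conj C)} :=
  HB.pack q (bilinear_isBilinear.Build C V V C _ _ q psd_bilinear)
    (isHermitianSesquilinear.Build C V false _ q psd_hermitian)
    (isDotProduct.Build C V q psd_positive).

End DotOfPsdForm.

(** * The complex line as a Hilbert space, and monotone limits *)

Section ComplexLine.
Variable R : realType.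
Local Notation C := (R[i]^o).

Lemma norm_ge_Im (z : R[i]) : `|complex.Im z|%:C%C <= `|z|.
Proof.
have := normc_ge_Re (z * 'i%C); rewrite ReiNIm normrN normrM.
by rewrite [`|'i%C|]normc_def /= expr0n expr1n add0r sqrtr1 mulr1.
Qed.

Lemma norm_le_ReIm (z : R[i]) :
  `|z| <= (`|complex.Re z| + `|complex.Im z|)%:C%C.
Proof.
rewrite {1}[z]complexE (le_trans (ler_normD _ _)) // normrM.
rewrite !normc_def /= !expr0n /= !expr1n !add0r !addr0 sqrtr1 mul1r.
by rewrite !sqrtr_sqr -rmorphD.
Qed.

Lemma cauchy_part (part : C -> R) (F : set_system C) :
  {morph part : x y / x - y} -> (forall z, `|part z|%:C%C <= `|z|) ->
  ProperFilter F -> cauchy F ->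
  exists l : R, part @ F --> l.
Proof.
move=> partB part_le FF Fc; exists (lim (part @ F)).
apply: cauchy_cvg; apply/cauchyP => e e0.
have /cauchyP/(_ e%:C%C) [] := Fc; first by rewrite ltcR.
move=> x Fx; exists (part x); change (F (part @^-1` ball (part x) e)).
apply: filterS Fx => z; rewrite -!ball_normE /= => xz.
by rewrite -ltcR -partB; exact: le_lt_trans (part_le _) xz.
Qed.

Lemma ReB : {morph (@complex.Re R : C -> R) : x y / x - y}.
Proof. by move=> [? ?] [? ?]. Qed.

Lemma ImB : {morph (@complex.Im R : C -> R) : x y / x - y}.
Proof. by move=> [? ?] [? ?]. Qed.

Lemma complex_complete (F : set_system C) :
  ProperFilter F -> cauchy F -> cvg F.
Proof.
move=> FF Fc.
have [a Fa] := cauchy_part ReB (@normc_ge_Re R) FF Fc.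
have [b Fb] := cauchy_part ImB norm_ge_Im FF Fc.
apply/cvg_ex; exists (a +i* b)%C.
apply/cvgrPdist_lt => e /pos_complexP[r r0 ->].
have r20 : 0 < r / 2 by rewrite divr_gt0.
near=> z; apply: le_lt_trans (norm_le_ReIm _) _; rewrite ltcR.
rewrite [r]splitr ltrD //.
  rewrite ?ReB ?ImB /=; near: z; exact: cvgr_dist_lt Fa _ r20.
rewrite ?ReB ?ImB /=; near: z; exact: cvgr_dist_lt Fb _ r20.
Unshelve. all: by end_near. Qed.

Lemma complex_separable : exists2 A : set C, countable A & dense A.
Proof.
pose g (p : rat * rat) : C := (ratr p.1 +i* ratr p.2)%C.
exists (range g); first exact: sub_countable (card_image_le _ _) _.
apply/dense_approx => x e /pos_complexP[r r0 ->].
have r20 : 0 < r / 2 by rewrite divr_gt0.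
have H (a : R) : exists q : rat, `|a - ratr q| < r / 2.
  have [q] : exists q, ratr q \in `]a - r / 2, a + r / 2[.
    by apply: rat_in_itvoo; lra.
  rewrite in_itv /= => /andP[q1 q2]; exists q.
  by rewrite distrC ltr_distl q1 q2.
have [p Hp] := H (complex.Re x); have [q Hq] := H (complex.Im x).
exists (g (p, q)); first by exists (p, q).
apply: le_lt_trans (norm_le_ReIm _) _; rewrite ltcR [ltRHS]splitr ltrD //.
  by rewrite ReB.
by rewrite raddfB.
Qed.

Definition complex_completeNormedMod : completeNormedModType R[i] :=
  HB.pack C (Uniform_isComplete.Build C complex_complete).

Definition cdot (x y : C) : R[i] := x * y^*.

Lemma cdot_psd : psd_form cdot.
Proof.
split=> [a x y z|x y|x]; rewrite /cdot.
- by rewrite mulrDl -mulrA.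
- by rewrite rmorphM /= conjCK mulrC.
- by rewrite -normCK exprn_ge0.
Qed.

Lemma cdot_norm (x : C) : cdot x x = `|x| ^+ 2.
Proof. by rewrite normCK. Qed.

Lemma cdot_definite (x : C) : x != 0 -> cdot x x != 0.
Proof. by rewrite cdot_norm expf_eq0 normr_eq0. Qed.

(* Packed by hand: the instance that R^o is complete for a realType R already
   occupies the key of the alias _^o. *)
Definition complex_hilbert : hilbertType R :=
  HB.pack (complex_completeNormedMod : Type) complex_completeNormedMod
   (CompleteNormedModule_isHilbert.Build R complex_completeNormedMod
  (cdot_norm : forall x, psd_dot cdot_psd cdot_definite x x = _)
  complex_separable).

End ComplexLine.

Section MonotoneLimits.
Variable R : realType.
Local Notation C := (R[i]^o).

(** Comparable complex numbers have the same imaginary part, so the increments u n - u 0 are real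
    and the real monotone limit applies. *)
Lemma complex_nondecreasing_cvg (u : nat -> C) (M : R[i]) :
  (forall n, u n <= u n.+1) -> (forall n, u n <= M) ->
  exists l : C, u @ \oo --> l.
Proof.
move=> ui uM.
have u_homo : {homo u : m n / (m <= n)%N >-> m <= n}.
  exact: homo_leq le_trans ui.
pose v n : R := complex.Re (u n - u 0%N).
have vE n : u n = u 0%N + (v n)%:C%C.
  rewrite /v RRe_real; first by rewrite addrC subrK.
  by rewrite ger0_real // subr_ge0 u_homo.
have v_homo : {homo v : m n / (m <= n)%N >-> m <= n}.
  by move=> m n mn; rewrite -lecR -(lerD2l (u 0%N)) -!vE; exact: u_homo.
have [l vl] : exists l : R, v @ \oo --> l.
  exists (lim (v @ \oo)); apply: nondecreasing_is_cvgn => //.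
  exists (complex.Re (M - u 0%N)) => _ [n _ <-].
  by have := uM n; rewrite -(lerD2r (- u 0%N)) lecE => /andP[].
exists (u 0%N + l%:C%C); apply/cvgrPdist_lt => e /pos_complexP[r r0 ->].
near=> n; rewrite (vE n) opprD addrACA subrr add0r -rmorphB normc_def /=.
rewrite expr0n /= addr0 sqrtr_sqr ltcR; near: n.
exact: cvgr_dist_lt vl _ r0.
Unshelve. all: by end_near. Qed.

Lemma cvg_le_seq (u v : nat -> C) (a b : C) :
  (forall n, u n <= v n) -> u @ \oo --> a -> v @ \oo --> b -> a <= b.
Proof.
move=> uv ua vb; rewrite -subr_ge0.
apply: (@cvg_ge0 _ _ \oo _ (fun n => v n - u n)).
  by exists 0%N => // n _; rewrite /= subr_ge0.
exact: (@cvgB _ C _ \oo _ v u b a vb ua).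
Qed.

Lemma cvg_conj (u : nat -> C) (l : C) :
  u @ \oo --> l -> (fun n => (u n)^* : C) @ \oo --> (l^* : C).
Proof.
move=> /cvgrPdist_lt ul; apply/cvgrPdist_lt => e e0.
by apply: filterS (ul e e0) => n; rewrite -rmorphB norm_conjC.
Qed.

End MonotoneLimits.

(** * The Hilbert space of square-summable sequences *)

Section PsdNorm.
Variables (C : numClosedFieldType) (V : lmodType C) (q : V -> V -> C).
Hypothesis qP : psd_form q.

Lemma psd_triangle x y :
  sqrtC (q (x + y) (x + y)) <= sqrtC (q x x) + sqrtC (q y y).
Proof.
have qx0 := psd_ge0 qP x; have qy0 := psd_ge0 qP y.
rewrite -(@ler_pXn2r _ 2) ?nnegrE ?addr_ge0 ?sqrtC_ge0 ?(psd_ge0 qP) //.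
rewrite sqrtCK sqrrD !sqrtCK.
have -> : q (x + y) (x + y) = q x x + (q x y + (q x y)^*) + q y y.
  by rewrite (psdDl qP) !(psdDr qP) (psd_herm qP y x); ring.
rewrite lerD2r lerD2l.
have -> : q x y + (q x y)^* = 'Re (q x y) *+ 2.
  by rewrite ReE -mulr_natl mulrC divfK // pnatr_eq0.
rewrite lerMn2r /=; apply: (@le_trans _ _ `|q x y|); first exact: leif_Re_Creal.
rewrite -(@ler_pXn2r _ 2) ?nnegrE ?mulr_ge0 ?sqrtC_ge0 // exprMn !sqrtCK.
exact: psd_CauchySchwarz.
Qed.

(** Reduces questions on [q x y] to the diagonal: convergence of inner products in [l2], and
    equality of two forms with the same norms. *)
Lemma psd_polarization x y :
  q x y = (q (x + y) (x + y) - q (x - y) (x - y)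
           + 'i * (q (x + 'i *: y) (x + 'i *: y)
                   - q (x - 'i *: y) (x - 'i *: y))) / 4.
Proof.
rewrite !(psdBl qP) !(psdDl qP) !(psdBr qP) !(psdDr qP) !(psdZl qP) !(psdZr qP).
rewrite conjCi; have i2 : 'i * 'i = -1 :> C by rewrite -expr2 sqrCi.
apply: (canRL (mulfK _)); first by rewrite pnatr_eq0.
transitivity (2 * q x y + 2 * q y x + 2 * ('i * 'i) * (q y x - q x y));
  last by ring.
by rewrite i2; ring.
Qed.

End PsdNorm.

Section SquareSummable.
Variables (R : realType) (V : hilbertType R).
Local Notation C := (R[i]^o).
Implicit Types f g : nat -> V.

Definition psum (n : nat) f g : C := \sum_(i < n) hdot (f i) (g i).

Lemma psum_psd n : psd_form (psum n).
Proof.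
have qP := hdot_psd V.
split=> [a x y z|x y|x]; rewrite /psum.
- rewrite mulr_sumr -big_split /=; apply: eq_bigr => i _.
  by rewrite (psd_linear qP).
- by rewrite rmorph_sum; apply: eq_bigr => i _; exact: hdotC.
- by apply: sumr_ge0 => i _; exact: psd_ge0.
Qed.

Lemma psumS n f g : psum n.+1 f g = psum n f g + hdot (f n) (g n).
Proof. exact: big_ord_recr. Qed.

Lemma psum_homo f :
  {homo (fun n => psum n f f) : m n / (m <= n)%N >-> m <= n}.
Proof.
have H n : psum n f f <= psum n.+1 f f.
  by rewrite psumS lerDl (psd_ge0 (hdot_psd V)).
exact: homo_leq le_trans H.
Qed.

Definition l2_pred : {pred (nat -> V)} :=
  fun f => `[< exists M : R[i], forall n, psum n f f <= M >].

Lemma l2_predP f :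
  reflect (exists M : R[i], forall n, psum n f f <= M) (f \in l2_pred).
Proof. exact: asboolP. Qed.

Lemma l2_submod : submod_closed l2_pred.
Proof.
split=> [|a f g /l2_predP[M HM] /l2_predP[N HN]]; apply/l2_predP.
  by exists 0 => n; rewrite (psd0r (psum_psd n)).
exists (2 * (`|a| ^+ 2 * M) + 2 * N) => n.
have qP := psum_psd n.
(* Half of the parallelogram law: positivity at a f - g bounds the value at a f + g by twice the sum
   of the two values. *)
have := psd_ge0 qP (a *: f - g).
rewrite (psdBl qP) !(psdBr qP) (psdDl qP) !(psdDr qP) => h.
apply: (@le_trans _ _ (2 * psum n (a *: f) (a *: f) + 2 * psum n g g)).
  rewrite -subr_ge0 (le_trans h) // le_eqVlt; apply/orP; left.
  by apply/eqP; ring.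
rewrite (psdZl qP) (psdZr qP) [a * _]mulrA -normCK.
by rewrite lerD // ler_wpM2l ?ler0n // ler_wpM2l // exprn_ge0.
Qed.

HB.instance Definition _ := GRing.isSubmodClosed.Build _ _ l2_pred l2_submod.

Record l2 := L2 { l2_seq :> nat -> V ; _ : l2_seq \in l2_pred }.

HB.instance Definition _ := [isSub for l2_seq].
HB.instance Definition _ := [Choice of l2 by <:].
HB.instance Definition _ := [SubChoice_isSubLmodule of l2 by <:].

Implicit Types x y z : l2.

Lemma l2_bounded x : exists M : R[i], forall n, psum n x x <= M.
Proof. exact/l2_predP/(valP x). Qed.

Lemma l2_ext x y : (forall i, x i = y i) -> x = y.
Proof. by move=> xy; apply: val_inj; apply/funext. Qed.

Lemma l2_seq_linear a x y i : (a *: x + y) i = a *: x i + y i.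
Proof. by []. Qed.

Lemma l2_seqB x y i : (x - y) i = x i - y i.
Proof. by []. Qed.

Lemma l2_psum_psd n : psd_form (fun x y => psum n x y).
Proof.
have qP := psum_psd n; split=> [a x y z|x y|x].
- exact: psd_linear qP a x y z.
- exact: psd_herm qP x y.
- exact: psd_ge0 qP x.
Qed.

Definition l2_dot x y : R[i] := lim ((fun n => psum n x y) @ \oo).

Lemma psum_norm_cvg x : exists l : C, (fun n => psum n x x) @ \oo --> l.
Proof.
have [M HM] := l2_bounded x.
apply: complex_nondecreasing_cvg HM => n; exact: psum_homo.
Qed.

Lemma l2_dot_cvg x y : (fun n => psum n x y) @ \oo --> (l2_dot x y : C).
Proof.
have [a xa] := psum_norm_cvg (x + y); have [b xb] := psum_norm_cvg (x - y).
have [c xc] := psum_norm_cvg (x + 'i *: y).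
have [d xd] := psum_norm_cvg (x - 'i *: y).
suff H : (fun n => psum n x y) @ \oo --> ((a - b + 'i * (c - d)) * 4^-1 : C).
  exact: (cvgP _ H).
under eq_fun do rewrite (psd_polarization (l2_psum_psd _)).
apply: (@cvgMl _ _ \oo).
apply: (@cvgD _ C _ \oo); first exact: (@cvgB _ C _ \oo _ _ _ _ _ xa xb).
apply: (@cvgMr _ _ \oo).
exact: (@cvgB _ C _ \oo _ _ _ _ _ xc xd).
Qed.

Lemma l2_dot_unique x y (l : C) :
  (fun n => psum n x y) @ \oo --> l -> l2_dot x y = l.
Proof.
by move=> H; exact: (@norm_cvg_unique _ C (_ @ \oo) _ _ _ (@l2_dot_cvg x y) H).
Qed.

Lemma l2_dot_psd : psd_form l2_dot.
Proof.
split=> [a x y z|x y|x].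
- apply: l2_dot_unique.
  under eq_fun do rewrite (psd_linear (l2_psum_psd _)).
  apply: (@cvgD _ C _ \oo); last exact: l2_dot_cvg.
  by apply: (@cvgMr _ _ \oo); exact: l2_dot_cvg.
- apply: l2_dot_unique.
  under eq_fun do rewrite (psd_herm (l2_psum_psd _)).
  exact/cvg_conj/l2_dot_cvg.
- apply: (@cvg_le_seq _ (fun=> 0) (fun n => psum n x x)).
  + by move=> n; exact: psd_ge0 (l2_psum_psd n) _.
  + exact: cvg_cst.
  + exact: l2_dot_cvg.
Qed.

Lemma psum_le_dot n x : psum n x x <= l2_dot x x.
Proof.
apply: (@cvg_ge_const _ _ \oo _ _ _ _ (@l2_dot_cvg x x)).
by exists n => // m /= nm; exact: psum_homo.
Qed.

Lemma l2_dot_le x (M : R[i]) : (forall n, psum n x x <= M) -> l2_dot x x <= M.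
Proof.
move=> HM; apply: (@cvg_le_seq _ (fun n => psum n x x) (fun=> M)) => //.
  exact: l2_dot_cvg.
exact: cvg_cst.
Qed.

Lemma l2_dot_eq0 x : l2_dot x x = 0 -> x = 0.
Proof.
move=> x0; apply: l2_ext => i.
have := psum_le_dot i.+1 x; rewrite x0 psumS => h.
apply/eqP; rewrite -normr_eq0 -sqrf_eq0 -hdot_norm eq_le.
rewrite (psd_ge0 (hdot_psd V)) andbT (le_trans _ h) // lerDr.
exact: psd_ge0 (psum_psd i) x.
Qed.

Lemma l2_dot_definite x : x != 0 -> l2_dot x x != 0.
Proof. by apply: contra_neq; exact: l2_dot_eq0. Qed.

Definition l2_norm x : R[i] := sqrtC (l2_dot x x).

Lemma l2_normD x y : l2_norm (x + y) <= l2_norm x + l2_norm y.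
Proof. exact: psd_triangle l2_dot_psd x y. Qed.

Lemma l2_normZ (a : R[i]) x : l2_norm (a *: x) = `|a| * l2_norm x.
Proof.
rewrite /l2_norm (psdZl l2_dot_psd) (psdZr l2_dot_psd) mulrA -normCK.
by rewrite rootCMl ?exprn_ge0 // sqrCK.
Qed.

Lemma l2_norm_eq0 x : l2_norm x = 0 -> x = 0.
Proof. by move/eqP; rewrite sqrtC_eq0 => /eqP /l2_dot_eq0. Qed.

HB.instance Definition _ := Lmodule_isNormed.Build R[i] l2
  l2_normD l2_normZ l2_norm_eq0.

Lemma l2_dot_norm x : l2_dot x x = `|x| ^+ 2.
Proof. by rewrite [`|x|]/(l2_norm x) sqrtCK. Qed.

End SquareSummable.

Lemma dense_seq (R : realType) (V : hilbertType R) : exists d : nat -> V,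
  forall (x : V) (e : R[i]), 0 < e -> exists n, `|x - d n| < e.
Proof.
have [D /countable_injP[f finj] /dense_approx dD] := @hilbert_separable R V.
exists (fun n => xget 0 [set v | D v /\ f v = n]) => x e e0.
have [v Dv xv] := dD x e e0; exists (f v).
set d := xget _ _.
have [Dd fd] : D d /\ f d = f v.
  exact: (@xgetPex _ 0 [set w | D w /\ f w = f v]
    (ex_intro _ v (conj Dv erefl))).
by rewrite (finj d v) //; exact/mem_set.
Qed.

Section SquareSummableComplete.
Variables (R : realType) (V : hilbertType R).
Local Notation C := (R[i]^o).
Implicit Types x y z : l2 V.

Lemma norm_le_sqr (U : normedModType R[i]) (u : U) (a : R[i]) :
  0 <= a -> (`|u| <= a) = (`|u| ^+ 2 <= a ^+ 2).
Proof. by move=> a0; rewrite ler_pXn2r // nnegrE. Qed.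

Lemma l2_coord_le x i : `|x i| <= `|x|.
Proof.
rewrite norm_le_sqr // -hdot_norm -l2_dot_norm.
rewrite (le_trans _ (psum_le_dot i.+1 x)) //.
by rewrite psumS lerDr (psd_ge0 (psum_psd V i)).
Qed.

Lemma l2_norm_le x (M : R[i]) :
  0 <= M -> (forall n, psum n x x <= M ^+ 2) -> `|x| <= M.
Proof. by move=> M0 HM; rewrite norm_le_sqr // -l2_dot_norm l2_dot_le. Qed.

Lemma psum_le_norm n x : psum n x x <= `|x| ^+ 2.
Proof. by rewrite -l2_dot_norm psum_le_dot. Qed.

Lemma l2_coord_cvg (F : set_system (l2 V)) i : ProperFilter F -> cauchy F ->
  exists v : V, (fun x => x i) @ F --> v.
Proof.
move=> FF Fc; exists (lim ((fun x : l2 V => x i) @ F)).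
apply: cauchy_cvg; apply/cauchyP => e e0.
have /cauchyP/(_ e e0)[x Fx] := Fc.
exists (x i); change (F ((fun x : l2 V => x i) @^-1` ball (x i) e)).
apply: filterS Fx => z; rewrite -!ball_normE /= => xz.
by rewrite -l2_seqB; exact: le_lt_trans (l2_coord_le _ _) xz.
Qed.

Lemma cvg_psum_norm T (F : set_system T) (FF : Filter F) (x : T -> nat -> V)
    (y : nat -> V) n :
  (forall i, (fun t => x t i) @ F --> y i) ->
  (fun t => psum n (x t) (x t)) @ F --> (psum n y y : C).
Proof.
move=> xy; elim: n => [|n IH].
  rewrite /psum big_ord0; under eq_fun do rewrite big_ord0.
  exact: cvg_cst.
rewrite psumS; under eq_fun do rewrite psumS.
apply: (@cvgD _ C _ F); first exact: IH.
rewrite hdot_norm; under eq_fun do rewrite hdot_norm.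
have xn : (fun t => `|x t n|) @ F --> (`|y n| : C) by exact: cvg_norm.
rewrite expr2; under eq_fun do rewrite expr2.
exact: (@cvgM R[i] _ F).
Qed.

Lemma l2_complete (F : set_system (l2 V)) : ProperFilter F -> cauchy F -> cvg F.
Proof.
move=> FF Fc.
have /choice[g Fg] := fun i => l2_coord_cvg i FF Fc.
(* For fixed n only finitely many coordinates occur, so the Cauchy bound passes to the
   coordinatewise limit [g]; the bound obtained does not depend on n. *)
have near_g e : 0 < e -> exists2 x, F (ball x e) &
    forall n, psum n (fun i => x i - g i) (fun i => x i - g i) <= e ^+ 2.
  move=> e0; have /cauchyP/(_ e e0)[x Fx] := Fc; exists x => // n.
  have Fd : (fun z : l2 V => psum n (x - z) (x - z)) @ F -->
      (psum n (fun i => x i - g i) (fun i => x i - g i) : C).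
    apply: cvg_psum_norm => i; under eq_fun do rewrite l2_seqB.
    by apply: cvgB => //; exact: cvg_cst.
  apply: (@cvg_le_const _ _ F _ _ _ _ _ Fd).
  apply: filterS Fx => z; rewrite -ball_normE /= => xz.
  apply: le_trans (psum_le_norm n (x - z)) _.
  by rewrite ler_pXn2r ?nnegrE // ltW.
have g_l2 : g \in @l2_pred R V.
  have [x _ Hx] := near_g 1 ltr01.
  have -> : g = (x : nat -> V) - (fun i => x i - g i).
    by apply/funext => i; rewrite /= fctE opprB addrC subrK.
  rewrite rpredB ?(valP x) //; apply/l2_predP; exists (1 ^+ 2) => n; exact: Hx.
apply/cvg_ex; exists (L2 g_l2); apply/cvgrPdist_lt => e e0.
have e2 : 0 < e / 2 by rewrite divr_gt0.
have [x Fx Hx] := near_g _ e2.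
apply: filterS Fx => z; rewrite -ball_normE /= => xz.
rewrite [e]splitr -(subrKA x) (le_lt_trans (ler_normD _ _)) //.
rewrite ler_ltD // distrC; apply: l2_norm_le => [|n]; first exact: ltW.
exact: Hx.
Qed.

HB.instance Definition _ := Uniform_isComplete.Build (l2 V) l2_complete.

Definition delta_seq (k : nat) (v : V) : nat -> V :=
  fun i => if i == k then v else 0.

Lemma psum_delta f k v n :
  psum n f (delta_seq k v) = if (k < n)%N then hdot (f k) v else 0.
Proof.
have qP := hdot_psd V.
elim: n => [|n IH]; first by rewrite /psum big_ord0.
rewrite psumS IH /delta_seq ltnS.
have [->|nk] := eqVneq n k; first by rewrite ltnn leqnn add0r.
by rewrite (psd0r qP) addr0 [in RHS]leq_eqVlt eq_sym (negPf nk).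
Qed.

Lemma delta_l2 k v : delta_seq k v \in @l2_pred R V.
Proof.
apply/l2_predP; exists (hdot v v) => n; rewrite psum_delta /delta_seq eqxx.
by case: ifP => // _; exact: psd_ge0 (hdot_psd V) v.
Qed.

Definition delta k v : l2 V := L2 (delta_l2 k v).

Lemma l2_dot_delta x k v : l2_dot x (delta k v) = hdot (x k) v.
Proof.
apply: l2_dot_unique; apply: cvg_near_cst.
by exists k.+1 => // n /= kn; rewrite psum_delta kn.
Qed.

Lemma delta_linear k : linear (delta k).
Proof.
move=> a u v; apply: l2_ext => i; rewrite l2_seq_linear /= /delta_seq.
by case: ifP => // _; rewrite scaler0 addr0.
Qed.

Lemma norm_delta k v : `|delta k v| = `|v|.
Proof.
apply/eqP; rewrite -(@eqrXn2 _ 2) // -l2_dot_norm l2_dot_delta /=.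
by rewrite /delta_seq eqxx hdot_norm.
Qed.

Lemma delta_bounded k : bounded_linear (delta k).
Proof.
by split; [exact: delta_linear|exists 1 => v; rewrite norm_delta mul1r].
Qed.

Definition l2_trunc n x : l2 V := \sum_(i < n) delta i (x i).

Lemma l2_trunc_dist n x : `|x - l2_trunc n x| ^+ 2 = `|x| ^+ 2 - psum n x x.
Proof.
have qP := l2_dot_psd V.
have H y : l2_dot y (l2_trunc n x) = psum n y x.
  by rewrite (psd_sumr qP); apply: eq_bigr => i _; rewrite l2_dot_delta.
rewrite -!l2_dot_norm (psdBl qP) !(psdBr qP) (psd_herm qP (l2_trunc n x) x) !H.
have -> : psum n (l2_trunc n x) x = psum n x x.
  apply: eq_bigr => i _; congr (hdot _ _).
  have -> : l2_trunc n x i = \sum_(j < n) (delta j (x j) : nat -> V) i.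
    by apply: (big_morph (fun y : l2 V => y i)).
  rewrite (bigD1 i) //= /delta_seq eqxx big1 ?addr0 // => j ji.
  by rewrite eq_sym (negPf (ji : (j : nat) != i)).
by rewrite -(psd_herm (psum_psd V n) x x) subrr subr0.
Qed.

Lemma l2_trunc_cvg x : (fun n => l2_trunc n x) @ \oo --> x.
Proof.
apply/cvgrPdist_lt => e e0.
have := @l2_dot_cvg R V x x => /cvgrPdist_lt/(_ _ (exprn_gt0 2 e0)).
apply: filterS => n; rewrite l2_dot_norm ger0_norm ?subr_ge0 ?psum_le_norm //.
by rewrite -l2_trunc_dist ltr_pXn2r ?nnegrE // ltW.
Qed.

Lemma l2_separable : exists2 A : set (l2 V), countable A & dense A.
Proof.
have [d dd] := dense_seq V.
pose h (s : seq nat) : l2 V := \sum_(i < size s) delta i (d (nth 0%N s i)).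
exists (range h); first exact: sub_countable (card_image_le _ _) _.
apply/dense_approx => x e e0.
have e2 : 0 < e / 2 by rewrite divr_gt0.
have /cvgrPdist_lt/(_ _ e2)[n _ /(_ n (leqnn n)) xn] := @l2_trunc_cvg x.
(* The n coordinate errors add up to less than e / 2; [n.+1] also covers n = 0. *)
have en : 0 < e / 2 / n.+1%:R by rewrite divr_gt0.
have /choice[k Hk] i := dd (x i) _ en.
exists (h (mkseq k n)); first by exists (mkseq k n).
rewrite [e]splitr -(subrKA (l2_trunc n x)) (le_lt_trans (ler_normD _ _)) //.
rewrite ltrD //.
have -> : h (mkseq k n) = \sum_(i < n) delta i (d (k i)).
  by rewrite /h size_mkseq; apply: eq_bigr => i _; rewrite nth_mkseq.
rewrite -sumrB (le_lt_trans (ler_norm_sum _ _ _)) //.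
apply: (@le_lt_trans _ _ (\sum_(i < n) (e / 2 / n.+1%:R))).
  apply: ler_sum => i _; rewrite -(linB _ _ (delta_linear i)) norm_delta.
  exact/ltW/Hk.
rewrite sumr_const card_ord -[_ *+ n]mulr_natr -mulrA gtr_pMr //.
by rewrite mulrC ltr_pdivrMr // mul1r ltr_nat.
Qed.

HB.instance Definition _ := CompleteNormedModule_isHilbert.Build R (l2 V)
  (@l2_dot_norm R V : forall x,
     psd_dot (@l2_dot_psd R V) (@l2_dot_definite R V) x x = _)
  l2_separable.

Lemma l2_total (L : set (l2 V)) :
  closed_subspace L -> (forall k v, L (delta k v)) -> forall x, L x.
Proof.
move=> [Lcl L0 Llin] Ld x; apply: closed_approx => // e e0.
have /cvgrPdist_lt/(_ e e0)[n _ /(_ n (leqnn n)) xn] := @l2_trunc_cvg x.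
exists (l2_trunc n x) => //; rewrite /l2_trunc.
elim/big_ind: _ => // y z Ly Lz.
by rewrite -[y]scale1r; exact: Llin.
Qed.

Lemma l2_hdotE x y : hdot x y = l2_dot x y.
Proof. by []. Qed.

End SquareSummableComplete.

(** * The Hardy space *)

Section HardySpace.
Variable R : realType.
Local Notation C := (R[i]^o).
Local Notation H2 := (l2 (complex_hilbert R)).

Section Tensors.
Variable V : hilbertType R.
Implicit Types (a b : H2) (u v : V) (x y : l2 V).

Definition tens_seq a v : nat -> V := fun i => (a i : R[i]) *: v.

Lemma psum_tens n a b u v :
  psum n (tens_seq a u) (tens_seq b v) = psum n a b * hdot u v.
Proof.
have qP := hdot_psd V.
rewrite /psum mulr_suml; apply: eq_bigr => i _.
by rewrite (psdZl qP) (psdZr qP) mulrA.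
Qed.

Lemma tens_l2 a v : tens_seq a v \in @l2_pred R V.
Proof.
apply/l2_predP; exists (l2_dot a a * hdot v v) => n; rewrite psum_tens.
by rewrite ler_wpM2r ?(psd_ge0 (hdot_psd V)) // psum_le_dot.
Qed.

Definition tens a v : l2 V := L2 (tens_l2 a v).

Lemma l2_dot_tens a b u v :
  l2_dot (tens a u) (tens b v) = l2_dot a b * hdot u v.
Proof.
apply: l2_dot_unique; under eq_fun do rewrite psum_tens.
by apply: (@cvgMl _ _ \oo); exact: l2_dot_cvg.
Qed.

Lemma norm_tens a v : `|tens a v| = `|a| * `|v|.
Proof.
apply/eqP; rewrite -(@eqrXn2 _ 2) ?mulr_ge0 // exprMn -!l2_dot_norm.
by rewrite l2_dot_tens hdot_norm.
Qed.

Lemma tens_linear a : linear (tens a).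
Proof.
move=> c u v; apply: l2_ext => i; rewrite l2_seq_linear /= /tens_seq.
by rewrite scalerDr !scalerA mulrC.
Qed.

Lemma tens_bounded a : bounded_linear (tens a).
Proof. by split; [exact: tens_linear|exists `|a| => v; rewrite norm_tens]. Qed.

Lemma psumSl n x y :
  psum n.+1 x y = hdot (x 0%N) (y 0%N) + psum n (x \o succn) (y \o succn).
Proof. exact: big_ord_recl. Qed.

Lemma bshift_l2 x : (x : nat -> V) \o succn \in @l2_pred R V.
Proof.
have [M HM] := l2_bounded x; apply/l2_predP; exists M => n.
by apply: le_trans (HM n.+1); rewrite psumSl lerDr (psd_ge0 (hdot_psd V)).
Qed.

Definition bshift x : l2 V := L2 (bshift_l2 x).

Lemma l2_dot_bshift x y :
  l2_dot x y = hdot (x 0%N) (y 0%N) + l2_dot (bshift x) (bshift y).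
Proof.
apply: l2_dot_unique; rewrite -cvg_shiftS.
under eq_fun do rewrite psumSl.
by apply: (@cvgD _ C _ \oo); [exact: cvg_cst|exact: l2_dot_cvg].
Qed.

Lemma bshift_le x : `|bshift x| <= `|x|.
Proof.
rewrite norm_le_sqr // -!l2_dot_norm [leRHS]l2_dot_bshift lerDr.
exact: psd_ge0 (hdot_psd V) _.
Qed.

End Tensors.

Definition szego_seq (w : disc R) : nat -> complex_hilbert R :=
  fun i => (val w)^* ^+ i.

Lemma szego_seq_l2 w : szego_seq w \in @l2_pred R (complex_hilbert R).
Proof.
apply/l2_predP; set r := `|val w| ^+ 2.
have r1 : r < 1 by rewrite expr_lt1 // (valP w).
exists (1 - r)^-1 => n.
rewrite (_ : psum n _ _ = \sum_(i < n) r ^+ i); last first.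
  apply: eq_bigr => i _; rewrite hdot_norm normrX norm_conjC.
  by rewrite -!exprM mulnC.
rewrite -[(1 - r)^-1]mul1r ler_pdivlMr ?subr_gt0 // mulrC.
by rewrite -opprB mulNr -subrX1 opprB gerBl exprn_ge0 ?exprn_ge0.
Qed.

Definition szego_vec w : H2 := L2 (szego_seq_l2 w).

Lemma bshift_szego w : bshift (szego_vec w) = (val w)^* *: szego_vec w.
Proof. by apply: l2_ext => i; rewrite /= /szego_seq exprS. Qed.

(** The geometric series is summed through the backward shift, for which the kernel vectors are
    eigenvectors: the sum satisfies s = 1 + z w^* s. *)
Lemma szego_vec_dot w z : l2_dot (szego_vec w) (szego_vec z) = szego z w.
Proof.
have qP := l2_dot_psd (complex_hilbert R).
set s := l2_dot _ _.
have : s * (1 - val z * (val w)^*) = 1.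
  rewrite mulrBr mulr1 {1}/s l2_dot_bshift !bshift_szego (psdZl qP) (psdZr qP).
  rewrite conjCK -/s /= /szego_seq !expr0 /cdot mul1r conjC1; ring.
move=> sE; have nz : 1 - val z * (val w)^* != 0.
  by apply: contra_eq_neq sE => ->; rewrite mulr0 eq_sym oner_eq0.
by apply: (mulIf nz); rewrite sE mulVf.
Qed.

Section Evaluation.
Variable V : hilbertType R.
Implicit Types (x y : l2 V) (w : disc R).

(* The value sum_i w^i x_i of the power series x at w, obtained without summing
   the series. *)
Definition l2_eval x w : V := adjoint (tens (szego_vec w)) x.

Lemma l2_evalP x w v : hdot (tens (szego_vec w) v) x = hdot v (l2_eval x w).
Proof. exact: adjointP (tens_bounded V _) v x. Qed.

Lemma l2_eval_linear a x y w :
  l2_eval (a *: x + y) w = a *: l2_eval x w + l2_eval y w.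
Proof. exact: adjoint_linear (tens_bounded V _) a x y. Qed.

Lemma l2_eval_continuous w : continuous (l2_eval^~ w).
Proof. exact/bounded_linear_is_continuous/adjoint_bounded/tens_bounded. Qed.

Lemma l2_eval_bshift x w : l2_eval x w = x 0%N + val w *: l2_eval (bshift x) w.
Proof.
have qP := hdot_psd V; apply: hdot_inj => v.
rewrite -l2_evalP (psdDr qP) (psdZr qP) -l2_evalP !l2_hdotE l2_dot_bshift.
have -> : bshift (tens (szego_vec w) v) = (val w)^* *: tens (szego_vec w) v.
  by apply: l2_ext => i; rewrite /= /tens_seq /= /szego_seq exprS -scalerA.
by rewrite (psdZl (l2_dot_psd V)) /= /tens_seq /= /szego_seq expr0 scale1r.
Qed.

Lemma l2_eval_le x w : `|l2_eval x w| <= `|szego_vec w| * `|x|.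
Proof.
apply: adjoint_le => [||v]; rewrite ?norm_tens //; exact: tens_linear.
Qed.

(** On this disc the diagonal is at most 4/3; the cruder 4 has an exact square root, which gives the
    norm bound 2 for kernel vectors near 0. *)
Lemma szego_diag_le w : `|val w| <= 2^-1 -> szego w w <= 4.
Proof.
move=> w2; rewrite /szego -normCK.
have h : `|val w| ^+ 2 <= 4^-1.
  rewrite (_ : 4^-1 = 2^-1 ^+ 2); last by rewrite exprVn -natrX.
  by rewrite ler_pXn2r ?nnegrE ?invr_ge0.
rewrite invf_ple ?posrE // ?subr_gt0 ?(le_lt_trans h) ?invf_lt1 ?ltr1n //.
rewrite lerBrDr -lerBrDl (le_trans h) //.
rewrite (_ : 1 - 4^-1 = 3 / 4); last by field.
by rewrite -[leLHS]mul1r ler_pM2r ?invr_gt0 // ler1n.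
Qed.

Lemma szego_vec_le w : `|val w| <= 2^-1 -> `|szego_vec w| <= 2.
Proof.
move=> /szego_diag_le h.
by rewrite norm_le_sqr // -l2_dot_norm szego_vec_dot -natrX.
Qed.

Lemma small_disc (e : R[i]) : 0 < e ->
  exists w : disc R, [/\ val w != 0, `|val w| <= 2^-1 & `|val w| < e].
Proof.
move=> /invn_small[n ne].
(* [n.+2] keeps the point at modulus at most 1/2. *)
have w1 : `|n.+2%:R^-1 : R[i]| < 1.
  by rewrite normfV normr_nat invf_lt1 ?ltr1n.
exists (exist _ (n.+2%:R^-1) w1); rewrite /= normfV normr_nat; split.
- by rewrite invr_neq0 // pnatr_eq0.
- by rewrite lef_pV2 ?posrE // ler_nat.
- by apply: lt_trans ne; rewrite ltf_pV2 ?posrE // ltr_nat.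
Qed.

(** The point 0 is left out so that the hypothesis passes on to [bshift x], which requires dividing
    by w. The head is still reached, since |x 0| <= 2 |w| |x| for all small w. *)
Lemma l2_eval_eq0_head x :
  (forall w, val w != 0 -> l2_eval x w = 0) -> x 0%N = 0.
Proof.
move=> x0; apply/eqP/negPn; rewrite -normr_gt0; apply/negP => h.
have e0 : 0 < `|x 0%N| / (2 * `|x| + 1).
  by rewrite divr_gt0 // ltr_wpDl ?mulr_ge0.
have [w [w0 w2 we]] := small_disc e0.
have := l2_eval_bshift x w; rewrite (x0 w w0) => /esym/eqP.
rewrite addr_eq0 => /eqP x0E.
have : `|x 0%N| <= `|val w| * (2 * `|x|).
  rewrite x0E normrN normrZ ler_wpM2l // (le_trans (l2_eval_le _ _)) //.
  by rewrite ler_pM // ?szego_vec_le // bshift_le.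
move=> /le_gtF/negbT/negP; apply.
rewrite ltr_pdivlMr ?ltr_wpDl ?mulr_ge0 // in we.
by apply: le_lt_trans we; rewrite ler_wpM2l // lerDl.
Qed.

Lemma l2_eval_inj : injective l2_eval.
Proof.
move=> x y xy; apply/eqP; rewrite -subr_eq0; apply/eqP; apply: l2_ext => i.
have : forall w, val w != 0 -> l2_eval (x - y) w = 0.
  move=> w _; rewrite -scaleN1r addrC l2_eval_linear scaleN1r.
  by rewrite xy addNr.
elim: i (x - y) => [|i IH] z z0; first exact: l2_eval_eq0_head.
apply: (IH (bshift z)) => w w0; have := l2_eval_bshift z w.
rewrite (z0 w w0) l2_eval_eq0_head // add0r => /esym/eqP.
by rewrite scaler_eq0 (negPf w0) => /eqP.
Qed.

HB.instance Definition _ := Hilbert_isFunHilbert.Build R V (l2 V)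
  l2_eval_linear l2_eval_inj l2_eval_continuous.

Lemma l2_eval_delta k v w : l2_eval (delta k v) w = val w ^+ k *: v.
Proof.
have qP := hdot_psd V; apply: hdot_inj => u.
rewrite -l2_evalP l2_hdotE l2_dot_delta (psdZr qP) rmorphXn.
exact: psdZl qP _ _ _.
Qed.

Lemma l2_fun_ofE x w : fun_of x w = l2_eval x w.
Proof. by []. Qed.

End Evaluation.

(** The Hardy space as the space of Taylor coefficient sequences. *)
Definition hardy : funHilbertType C :=
  (H2 : funHilbertType (complex_hilbert R)).

Lemma hardy_reproducing (f : hardy) w : fun_of f w = hdot f (szego_vec w).
Proof.
have := l2_evalP f w (1 : complex_hilbert R).
have -> : tens (szego_vec w) (1 : complex_hilbert R) = szego_vec w.
  by apply: l2_ext => i; rewrite /= /tens_seq /= [_ *: _]mulr1.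
have -> : hdot (1 : complex_hilbert R) (l2_eval f w) = (l2_eval f w)^*.
  exact: mul1r.
by move=> /(congr1 Num.conj); rewrite conjCK -hdotC => H; exact: esym H.
Qed.

Lemma hardy_szego : is_rkhs (@szego R) hardy.
Proof.
move=> w; exists (szego_vec w); split=> [|f]; last exact: hardy_reproducing.
by apply/funext => z; rewrite hardy_reproducing l2_hdotE szego_vec_dot.
Qed.

Lemma hardy_tensor (V : hilbertType R) : is_tensor hardy (l2 V).
Proof.
exists (fun f eta => tens f eta); split=> [f eta|f g eta xi|].
- apply/funext => w; apply: hdot_inj => v.
  rewrite -l2_evalP (psdZr (hdot_psd V)) hardy_reproducing -hdotC !l2_hdotE.
  exact: l2_dot_tens.
- exact: l2_dot_tens.
- apply/dense_approx => x e e0.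
  have /cvgrPdist_lt/(_ e e0)[n _ /(_ n (leqnn n)) xn] := @l2_trunc_cvg R V x.
  exists (l2_trunc n x) => //.
  exists n, (fun i => delta i (1 : complex_hilbert R)), (fun i => x i).
  apply: eq_bigr => i _; apply: l2_ext => k.
  rewrite /= /tens_seq /= /delta_seq.
  by case: ifP; rewrite ?scale1r ?scale0r.
Qed.

End HardySpace.

(** * Representation of bounded positive forms *)

Lemma psd_diag0 (C : numClosedFieldType) (V : lmodType C) (q : V -> V -> C)
    x e :
  psd_form q -> q e e = 0 -> q x x = q (x - e) (x - e).
Proof.
move=> qP e0; have xe := psd_null qP x e0.
by rewrite (psdBl qP) !(psdBr qP) e0 xe (psd_herm qP e x) xe conjC0 !subr0.
Qed.

Section PsdRepresentation.
Variables (R : realType) (V : hilbertType R) (q : V -> V -> R[i]).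
Hypotheses (qP : psd_form q) (q_le : forall x, q x x <= `|x| ^+ 2).

(** After step k the vector [e k] is null, so the residual at [x] equals the residual at x - e k,
    which is at most |x - e k|^2. Density of the sequence makes this small. *)
Lemma residuals_cvg0 (e : nat -> V) x (r : R[i]) :
  (forall (x : V) (r : R[i]), 0 < r -> exists n, `|x - e n| < r) -> 0 < r ->
  exists N, forall n, (N <= n)%N -> residuals q e n x x < r.
Proof.
move=> de r0; have s0 : 0 < sqrtC r by rewrite sqrtC_gt0.
have [k xk] := de x _ s0; exists k.+1 => n kn.
have rP := residuals_psd qP e n.
rewrite (psd_diag0 x rP (residuals_null qP e kn)).
apply: (le_lt_trans (residuals_le qP e n (x - e k))).
apply: (le_lt_trans (q_le _)).
by rewrite -[r]sqrtCK ltr_pXn2r ?nnegrE // ltW.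
Qed.

Lemma psd_represent : exists D : V -> l2 (complex_hilbert R),
  linear D /\ forall x, `|D x| ^+ 2 = q x x.
Proof.
have [e de] := dense_seq V.
pose phi x : nat -> complex_hilbert R := fun n => cholesky q e n x.
have phiE n x : psum n (phi x) (phi x) = q x x - residuals q e n x x.
  by rewrite -cholesky_sum.
have phi_l2 x : phi x \in @l2_pred R (complex_hilbert R).
  apply/l2_predP; exists (q x x) => n.
  by rewrite phiE gerBl (psd_ge0 (residuals_psd qP e n)).
exists (fun x => L2 (phi_l2 x)); split=> [a x y|x].
  by apply: l2_ext => n; rewrite l2_seq_linear; exact: cholesky_linear.
rewrite -l2_dot_norm; apply: l2_dot_unique.
apply/cvgrPdist_lt => r r0; have [N HN] := residuals_cvg0 x de r0.
exists N => // n /= Nn; rewrite phiE opprB addrC subrK ger0_norm ?HN //.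
exact: psd_ge0 (residuals_psd qP e n) _.
Qed.

End PsdRepresentation.

(* Schur's product theorem: factoring q as a sum of phi_k x * (phi_k y)^* turns
   the double sum into a sum of squared norms. *)
Lemma psd_schur (R : realType) (U V : hilbertType R) (q : U -> U -> R[i]) n
    (f : 'I_n -> U) (eta : 'I_n -> V) : psd_form q ->
  0 <= \sum_(i < n) \sum_(j < n) q (f i) (f j) * hdot (eta i) (eta j).
Proof.
move=> qP; pose e k := oapp f 0 (insub k).
have ef (i : 'I_n) : e i = f i by rewrite /e valK.
have hP := hdot_psd V.
(* After n steps every [f j] has been eliminated, so no remainder is left on these vectors. *)
have qE i j : q (f i) (f j) =
    \sum_(k < n) cholesky q e k (f i) * (cholesky q e k (f j))^*.
  rewrite cholesky_sum // (psd_null (residuals_psd qP e n)) ?subr0 //.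
  by rewrite -(ef j) residuals_null.
rewrite (_ : \sum_(i < n) _ = \sum_(k < n)
  `|\sum_(i < n) cholesky q e k (f i) *: eta i| ^+ 2).
  by apply: sumr_ge0 => k _; rewrite exprn_ge0.
under eq_bigr => i _ do under eq_bigr => j _ do rewrite qE mulr_suml.
under eq_bigr => i _ do rewrite exchange_big /=.
rewrite exchange_big /=; apply: eq_bigr => k _.
rewrite -hdot_norm (psd_suml hP); apply: eq_bigr => i _.
rewrite (psd_sumr hP); apply: eq_bigr => j _.
by rewrite (psdZl hP) (psdZr hP) mulrA.
Qed.

(** * The shift on a tensor product *)

Section Multiplication.
Variables (R : realType) (E1 E2 : normedModType R[i]).
Variables (H1 : funHilbertType E1) (H2 : funHilbertType E2).
Implicit Type Theta : disc R -> E1 -> E2.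

Lemma eval_bounded (w : disc R) : bounded_linear (fun f : H1 => fun_of f w).
Proof.
apply: continuous_bounded_linear; last exact: Defs.eval_continuous.
by move=> a f g; exact: fun_of_linear.
Qed.

Lemma mul_opP Theta : multiplier H1 H2 Theta -> forall f w,
  fun_of (mul_op H1 H2 Theta f) w = Theta w (fun_of f w).
Proof.
move=> [_ HT] f w; have [g Hg] := HT f.
have := @xgetPex _ 0 [set g : H2 | fun_of g = (fun w => Theta w (fun_of f w))]
  (ex_intro _ g Hg).
by move=> /= /(congr1 (@^~ w)).
Qed.

Lemma mul_op_unique Theta : multiplier H1 H2 Theta -> forall f g,
  (forall w, fun_of g w = Theta w (fun_of f w)) -> mul_op H1 H2 Theta f = g.
Proof.
move=> mT f g H; apply: fun_of_inj; apply/funext => w.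
by rewrite mul_opP.
Qed.

Lemma mul_op_linear Theta : multiplier H1 H2 Theta ->
  linear (mul_op H1 H2 Theta).
Proof.
move=> mT a f g; apply: mul_op_unique => // w.
by rewrite !fun_of_linear !mul_opP // (proj1 (proj1 mT w)).
Qed.

End Multiplication.

Lemma coord_bounded (R : realType) (E : normedModType R[i]) (w : disc R) :
  bounded_linear (@Defs.coord R E w).
Proof.
split=> [a x y|]; first by rewrite /Defs.coord scalerDr !scalerA mulrC.
by exists `|val w| => x; rewrite normrZ.
Qed.

Lemma iter_contraction (R : realType) (V : hilbertType R) (T : V -> V) m :
  Defs.contraction T -> Defs.contraction (iter m T).
Proof.
move=> [lT HT]; elim: m => [|m [lm Hm]]; first by split.
by split=> [a x y|x] /=; [rewrite lm lT|exact: le_trans (HT _) _].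
Qed.

(** Replacing [x] by a nearby [y] changes [T m x] by at most |x - y|, uniformly in m. *)
Lemma iter_cvg0_closed (R : realType) (V : hilbertType R) (T : nat -> V -> V) :
  (forall m, Defs.contraction (T m)) ->
  closed_subspace [set x | (fun m => T m x) @ \oo --> (0 : V)].
Proof.
move=> cT; split=> [x Hx||a x y Sx Sy] /=.
- apply/cvgrPdist_lt => e e0; have e2 : 0 < e / 2 by rewrite divr_gt0.
  have [y [/cvgrPdist_lt/(_ _ e2) Sy xy]] := Hx _ (nbhsx_ballx x _ e2).
  apply: filterS Sy => m; rewrite !sub0r !normrN => ym.
  have -> : T m x = T m (x - y) + T m y.
    by rewrite -(linD _ _ (proj1 (cT m))) subrK.
  rewrite [e]splitr (le_lt_trans (ler_normD _ _)) // ltrD //.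
  apply: le_lt_trans (proj2 (cT m) _) _.
  by move: xy; rewrite -ball_normE.
- under eq_fun do rewrite (lin0 (proj1 (cT _))).
  exact: cvg_cst.
- under eq_fun do rewrite (proj1 (cT _)).
  have : (fun m => a *: T m x + T m y) @ \oo --> (a *: 0 + 0 : V).
    by apply: cvgD => //; apply: cvgZr.
  by rewrite scaler0 addr0.
Qed.

Section TensorShift.
Variables (R : realType) (HK : funHilbertType R[i]^o) (E : hilbertType R).
Variables (HKE : funHilbertType E) (tens : HK -> E -> HKE).
Hypothesis tens_fun :
  forall f eta, fun_of (tens f eta) = (fun w => fun_of f w *: eta).
Hypothesis tens_dot : forall f g eta xi,
  hdot (tens f eta) (tens g xi) = hdot f g * hdot eta xi.
Hypothesis tens_dense : dense [set F : HKE |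
  exists (n : nat) (f : 'I_n -> HK) (eta : 'I_n -> E),
    F = \sum_(i < n) tens (f i) (eta i)].

Lemma ktens_linear f : linear (tens f).
Proof.
move=> a eta xi; apply: fun_of_inj; apply/funext => w.
by rewrite fun_of_linear !tens_fun scalerDr !scalerA mulrC.
Qed.

Lemma ktens_linearl eta : linear (tens^~ eta).
Proof.
move=> a f g; apply: fun_of_inj; apply/funext => w.
by rewrite fun_of_linear !tens_fun fun_of_linear scalerDl scalerA.
Qed.

Lemma norm_ktens f eta : `|tens f eta| = `|f| * `|eta|.
Proof.
apply/eqP; rewrite -(@eqrXn2 _ 2) ?mulr_ge0 // exprMn -!hdot_norm.
by rewrite tens_dot.
Qed.

Lemma tens_total (L : set HKE) :
  closed_subspace L -> (forall f eta, L (tens f eta)) -> forall F, L F.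
Proof.
move=> [Lcl L0 Llin] Lt F; apply: closed_approx => // e e0.
have [_ [n [f [eta ->]]] FG] := (proj1 (dense_approx _) tens_dense) F e e0.
exists (\sum_(i < n) tens (f i) (eta i)) => //.
elim/big_ind: _ => // x y Lx Ly.
by rewrite -[x]scale1r; exact: Llin.
Qed.

Variable A : HK -> HK.
Hypothesis cA : Defs.contraction A.

Lemma contraction_defect_psd :
  psd_form (fun f g => hdot f g - hdot (A f) (A g)).
Proof.
have qP := hdot_psd HK; split=> [a x y z|x y|x].
- by rewrite (proj1 cA) !(psd_linear qP); ring.
- by rewrite rmorphB /= -!hdotC.
- by rewrite !hdot_norm subr_ge0 ler_pXn2r ?nnegrE //; case: cA.
Qed.

Lemma norm_tens_sum n (f : 'I_n -> HK) (eta : 'I_n -> E) :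
  `|\sum_(i < n) tens (f i) (eta i)| ^+ 2 =
  \sum_(i < n) \sum_(j < n) hdot (f i) (f j) * hdot (eta i) (eta j).
Proof.
have qP := hdot_psd HKE.
rewrite -hdot_norm (psd_suml qP); apply: eq_bigr => i _.
by rewrite (psd_sumr qP); apply: eq_bigr => j _; exact: tens_dot.
Qed.

(** The graph of A (x) I on finite sums of simple tensors. It is a relation because a vector has
    many such expressions; that they all give the same image follows from the norm bound applied to
    differences. *)
Definition tens_graph (F G : HKE) : Prop :=
  exists (n : nat) (f : 'I_n -> HK) (eta : 'I_n -> E),
    F = \sum_(i < n) tens (f i) (eta i) /\
    G = \sum_(i < n) tens (A (f i)) (eta i).

(** |F|^2 - |G|^2 is the double sum of the defect form of [A] against the Gram matrix of the
    [eta i], hence nonnegative by Schur's theorem. *)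
Lemma tens_graph_le F G : tens_graph F G -> `|G| <= `|F|.
Proof.
move=> [n [f [eta [-> ->]]]]; rewrite norm_le_sqr // !norm_tens_sum -subr_ge0.
rewrite -sumrB; under eq_bigr => i _ do rewrite -sumrB.
under eq_bigr => i _ do under eq_bigr => j _ do rewrite -mulrBl.
exact: (psd_schur f eta contraction_defect_psd).
Qed.

Lemma tens_graphB F G F' G' :
  tens_graph F G -> tens_graph F' G' -> tens_graph (F - F') (G - G').
Proof.
move=> [n [f [eta [-> ->]]]] [m [g [xi [-> ->]]]].
exists (n + m)%N,
  (fun i => match fintype.split i with inl j => f j | inr k => g k end),
  (fun i => match fintype.split i with inl j => eta j | inr k => - xi k end).
rewrite !big_split_ord /=; split; congr (_ + _).
- by apply: eq_bigr => i _; rewrite (unsplitK (inl i)).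
- rewrite -sumrN; apply: eq_bigr => i _; rewrite (unsplitK (inr i)).
  by rewrite -[- xi i]scaleN1r (linZ _ _ (ktens_linear _)) scaleN1r.
- by apply: eq_bigr => i _; rewrite (unsplitK (inl i)).
- rewrite -sumrN; apply: eq_bigr => i _; rewrite (unsplitK (inr i)).
  by rewrite -[- xi i]scaleN1r (linZ _ _ (ktens_linear _)) scaleN1r.
Qed.

Hypothesis A_mul : forall f w, fun_of (A f) w = val w * fun_of f w.

Lemma tens_graph_fun F G w :
  tens_graph F G -> fun_of G w = val w *: fun_of F w.
Proof.
move=> [n [f [eta [-> ->]]]].
have lin := proj1 (@eval_bounded _ _ HKE w).
rewrite !(lin_sum _ _ lin) scaler_sumr; apply: eq_bigr => i _.
by rewrite !tens_fun A_mul scalerA.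
Qed.

(** Approximate [F] by finite sums. Their images under A (x) I are Cauchy by the bound on
    differences, and continuity of evaluation identifies the limit as z F. *)
Lemma coord_tens (F : HKE) :
  exists2 G : HKE, (forall w, fun_of G w = val w *: fun_of F w) & `|G| <= `|F|.
Proof.
have n0 n : 0 < n.+1%:R^-1 :> R[i] by rewrite invr_gt0.
have /choice[p Hp] (n : nat) : exists p : HKE * HKE,
    tens_graph p.1 p.2 /\ `|F - p.1| < n.+1%:R^-1.
  have [_ [m [f [eta ->]]] FG] :=
    (proj1 (dense_approx _) tens_dense) F _ (n0 n).
  exists (\sum_(i < m) tens (f i) (eta i), \sum_(i < m) tens (A (f i)) (eta i)).
  by split=> //; exists m, f, eta.
have pF : (fun n => (p n).1) @ \oo --> F.
  apply/cvgrPdist_lt => e /invn_small[n ne]; exists n => // m /= nm.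
  apply: lt_trans (proj2 (Hp m)) _; apply: le_lt_trans ne.
  by rewrite lef_pV2 ?posrE // ler_nat.
have [G pG] : exists G : HKE, (fun n => (p n).2) @ \oo --> G.
  apply: seq_complete => e e0.
  have [n ne] : exists n : nat, n.+1%:R^-1 < e / 2.
    by apply: invn_small; rewrite divr_gt0.
  exists n => m nm; have := tens_graphB (proj1 (Hp n)) (proj1 (Hp m)).
  move=> /tens_graph_le h; apply: le_lt_trans h _.
  rewrite [e]splitr -(subrKA F) (le_lt_trans (ler_normD _ _)) // ltrD //.
    by rewrite distrC; apply: lt_trans ne; case: (Hp n).
  apply: (lt_trans (proj2 (Hp m))); apply: le_lt_trans ne.
  by rewrite lef_pV2 ?posrE // ler_nat.
exists G => [w|].
  have ev := @Defs.eval_continuous _ _ HKE w.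
  have Gw := cvg_comp _ _ pG (ev G).
  have Fw := cvg_comp _ _ pF (ev F).
  apply: (@norm_cvg_unique _ E (_ @ \oo) _ _ _ Gw).
  rewrite (_ : _ \o _ = fun n => val w *: fun_of (p n).1 w); last first.
    by apply/funext => n /=; exact: tens_graph_fun (proj1 (Hp n)).
  by apply: cvgZr.
apply: (@cvg_le_seq _ (fun n => `|(p n).2|) (fun n => `|(p n).1|)).
- by move=> n; apply: tens_graph_le; case: (Hp n).
- exact: cvg_norm.
- exact: cvg_norm.
Qed.

Lemma tens_multiplier : multiplier HKE HKE (@Defs.coord R E).
Proof.
split=> [w|F]; first exact: coord_bounded.
by have [G HG _] := coord_tens F; exists G; exact/funext.
Qed.

Lemma tens_Mz_contraction : Defs.contraction (@Mz R E HKE).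
Proof.
split=> [|F]; first exact: mul_op_linear tens_multiplier.
have [G HG leG] := coord_tens F.
by rewrite /Mz (mul_op_unique tens_multiplier HG).
Qed.

Lemma Mz_tens f eta : Mz (tens f eta) = tens (A f) eta.
Proof.
apply: (mul_op_unique tens_multiplier) => w.
by rewrite !tens_fun A_mul /Defs.coord scalerA.
Qed.

Lemma adjoint_Mz_tens f eta :
  adjoint (@Mz R E HKE) (tens f eta) = tens (adjoint A f) eta.
Proof.
have bT := contraction_bounded tens_Mz_contraction.
have qP := hdot_psd HKE.
apply: adjoint_unique => //; apply: tens_total => [|g xi].
  apply: (@closed_subspace_eq _ _ R[i]^o); last exact: hdot_bounded.
  exact: bounded_linear_comp bT (hdot_bounded _).
by rewrite /= Mz_tens !tens_dot adjointP //; exact: contraction_bounded.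
Qed.

Lemma iter_adjoint_Mz_tens m f eta :
  iter m (adjoint (@Mz R E HKE)) (tens f eta) = tens (iter m (adjoint A) f) eta.
Proof. by elim: m => //= m ->; exact: adjoint_Mz_tens. Qed.

Hypothesis A_C0 : forall f : HK,
  (fun m : nat => iter m (adjoint A) f) @ \oo --> (0 : HK).

(** On simple tensors the powers of the adjoint act on the first factor only; the vectors sent to 0
    form a closed subspace, so simple tensors suffice. *)
Lemma tens_C_dot0 : C_dot0_contraction (@Mz R E HKE).
Proof.
split; first exact: tens_Mz_contraction.
have cT m := iter_contraction m (contraction_adjoint tens_Mz_contraction).
apply: tens_total => [|f eta]; last first.
  under eq_fun do rewrite iter_adjoint_Mz_tens.
  have bt : bounded_linear (tens^~ eta).
    split; first exact: ktens_linearl.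
    by exists `|eta| => g; rewrite norm_ktens mulrC.
  rewrite -(lin0 (proj1 bt)).
  exact: cvg_comp (@A_C0 f) (@bounded_linear_is_continuous _ _ _ _ bt 0).
exact: iter_cvg0_closed.
Qed.

End TensorShift.

(** * Invariant subspaces *)

Lemma hdot_adjointl (R : realType) (U V : hilbertType R) (A : U -> V) y u :
  bounded_linear A -> hdot (adjoint A y) u = hdot y (A u).
Proof. by move=> bA; rewrite hdotC -adjointP // -hdotC. Qed.

Section InvariantSubspace.
Variables (R : realType) (E' : hilbertType R) (H : funHilbertType E').
Hypothesis mz_mul : multiplier H H (@Defs.coord R E').
Hypothesis mz_C0 : C_dot0_contraction (@Mz R E' H).
Variable S : set H.
Hypothesis sS : closed_subspace S.
Hypothesis S_inv : forall f, S f -> S (Mz f).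

Local Notation T := (@Mz R E' H).
Local Notation T' := (adjoint T).
Local Notation P := (orthproj S).
Local Notation E := (l2 (complex_hilbert R)).

Let cT : Defs.contraction T := proj1 mz_C0.
Let bT : bounded_linear T := contraction_bounded cT.
Let cT' : Defs.contraction T' := contraction_adjoint cT.
Let lP : linear P := orthproj_linear sS.
Let qP := hdot_psd H.

(** Since [S] is invariant under [T], its orthogonal complement is invariant under [T'], so the
    component of [x] orthogonal to [S] does not contribute. *)
Lemma orthproj_adjoint_Mz x : P (T' (P x)) = P (T' x).
Proof.
apply: (orthproj_unique sS); first exact: orthproj_in.
move=> y Sy; rewrite orthproj_hdot // !hdot_adjointl //.
by rewrite orthproj_hdot //; exact: S_inv.
Qed.

(** The form of the operator P - T P T'. *)
Definition defect x y : R[i] := hdot (P x) (P y) - hdot (P (T' x)) (P (T' y)).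

Lemma defect_psd : psd_form defect.
Proof.
have lT' := proj1 cT'.
split=> [a x y z|x y|x]; rewrite /defect.
- by rewrite lT' !lP !(psd_linear qP); ring.
- by rewrite rmorphB /= -!hdotC.
- rewrite !hdot_norm subr_ge0 ler_pXn2r ?nnegrE // -orthproj_adjoint_Mz.
  exact: le_trans (proj2 (orthproj_contraction sS) _) (proj2 cT' _).
Qed.

Lemma defect_le x : defect x x <= `|x| ^+ 2.
Proof.
rewrite /defect lerBlDr ler_wpDr ?(psd_ge0 qP) // hdot_norm.
by rewrite ler_pXn2r ?nnegrE //; case: (orthproj_contraction sS).
Qed.

Section Dilation.
Variable D : H -> E.
Hypothesis D_lin : linear D.
Hypothesis D_norm : forall x, `|D x| ^+ 2 = defect x x.

(* Telescoping |D x|^2 = |P x|^2 - |P T' x|^2 along the orbit of x, together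
   with T'^m -> 0, makes |dilation x| = |P x|; the dilation turns T' into
   the backward shift, so that its adjoint W is a partial isometry onto S
   intertwining the shift with T. *)
Definition dilation_seq x : nat -> E := fun m => D (iter m T' x).

Lemma psum_dilation n x :
  psum n (dilation_seq x) (dilation_seq x) =
  `|P x| ^+ 2 - `|P (iter n T' x)| ^+ 2.
Proof.
elim: n => [|n IH]; first by rewrite /psum big_ord0 subrr.
by rewrite psumS IH hdot_norm D_norm /defect !hdot_norm addrA subrK.
Qed.

Lemma dilation_l2 x : dilation_seq x \in @l2_pred R E.
Proof.
apply/l2_predP; exists (`|P x| ^+ 2) => n.
by rewrite psum_dilation gerBl exprn_ge0.
Qed.

Definition dilation x : l2 E := L2 (dilation_l2 x).

Lemma norm_dilation x : `|dilation x| ^+ 2 = `|P x| ^+ 2.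
Proof.
rewrite -l2_dot_norm; apply: l2_dot_unique; apply/cvgrPdist_lt => e e0.
have s0 : 0 < sqrtC e by rewrite sqrtC_gt0.
have /cvgrPdist_lt/(_ _ s0) := @proj2 _ _ mz_C0 x.
apply: filterS => n; rewrite sub0r normrN psum_dilation opprB addrC subrK => h.
rewrite ger0_norm ?exprn_ge0 // -[e]sqrtCK.
rewrite ltr_pXn2r ?nnegrE ?normr_ge0 ?(ltW s0) //.
exact: le_lt_trans (proj2 (orthproj_contraction sS) _) h.
Qed.

Lemma dilation_bounded : bounded_linear dilation.
Proof.
split=> [a x y|].
  apply: l2_ext => m; rewrite l2_seq_linear /= /dilation_seq.
  by rewrite (proj1 (iter_contraction m cT')) D_lin.
exists 1 => x; rewrite mul1r norm_le_sqr // norm_dilation ler_pXn2r ?nnegrE //.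
by case: (orthproj_contraction sS).
Qed.

Local Notation W := (adjoint dilation).

(** By polarisation the norm identity becomes an identity of inner products, and the inner product
    of [P y] with [P x] is that of [y] with [P x]. *)
Lemma dilation_adjointK x : W (dilation x) = P x.
Proof.
apply: (adjoint_unique dilation_bounded) => y.
have normE z : hdot (dilation z) (dilation z) = hdot (P z) (P z).
  by rewrite !hdot_norm norm_dilation.
have bd := proj1 dilation_bounded.
have -> : hdot (dilation y) (dilation x) = hdot (P y) (P x).
  rewrite (psd_polarization (hdot_psd _)) [RHS](psd_polarization qP).
  rewrite -!(linZ _ _ bd, linD _ _ bd, linB _ _ bd) !normE.
  by rewrite -!(linZ _ _ lP, linD _ _ lP, linB _ _ lP).
by rewrite orthproj_hdot //; exact: orthproj_in.
Qed.

(** The part [u] of [W x] orthogonal to [S] has P u = 0, hence dilation u = 0. So [u] is orthogonal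
    to [W x] as well as to [P (W x)], and therefore to itself. *)
Lemma dilation_adjoint_in x : S (W x).
Proof.
set u := W x - P (W x).
have Pu : P u = 0.
  rewrite (linB _ _ lP) [P (P _)]orthproj_id ?subrr //; exact: orthproj_in.
have u0 : u = 0.
  apply/eqP; rewrite -normr_eq0 -sqrf_eq0 -hdot_norm {2}/u (psdBr qP).
  rewrite [hdot u (P _)](proj2 (orthproj_spec sS (W x))) ?subr0; last first.
    exact: orthproj_in.
  rewrite -(adjointP dilation_bounded).
  have -> : dilation u = 0.
    by apply/eqP; rewrite -normr_eq0 -sqrf_eq0 norm_dilation Pu normr0 expr0n.
  by rewrite (psd0l (hdot_psd _)).
by move/eqP: u0; rewrite subr_eq0 => /eqP ->; exact: orthproj_in.
Qed.

(** Dual to the fact that entry n of the dilation of [y] is entry 0 of the dilation of T'^n y. As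
    [delta n eta] is the monomial z^n eta, this is the intertwining relation on monomials. *)
Lemma dilation_adjoint_delta n eta :
  W (delta n eta) = iter n T (W (delta 0 eta)).
Proof.
apply: hdot_inj => y; rewrite -(adjointP dilation_bounded).
have iterP m u v : hdot u (iter m T v) = hdot (iter m T' u) v.
  elim: m u v => // m IH u v; rewrite iterS -hdot_adjointl // IH.
  by rewrite -iterSr.
rewrite iterP -(adjointP dilation_bounded) !l2_hdotE !l2_dot_delta.
by [].
Qed.

Definition symbol (w : disc R) (eta : E) : E' := fun_of (W (delta 0 eta)) w.

Lemma symbol_bounded w : bounded_linear (symbol w).
Proof.
have bW := adjoint_bounded dilation_bounded.
exact: bounded_linear_comp (bounded_linear_comp (delta_bounded E 0) bW)
  (eval_bounded H w).
Qed.

(** Both sides are bounded linear in [x], so monomials suffice; there [T] multiplies values by the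
    coordinate. *)
Lemma dilation_adjoint_fun x w : fun_of (W x) w = symbol w (fun_of x w).
Proof.
have bW := adjoint_bounded dilation_bounded.
move: x; apply: l2_total => [|n eta].
  apply: closed_subspace_eq.
    exact: bounded_linear_comp bW (eval_bounded H w).
  exact: bounded_linear_comp (eval_bounded (l2 E) w) (symbol_bounded w).
rewrite /= dilation_adjoint_delta l2_fun_ofE l2_eval_delta.
rewrite (linZ _ _ (proj1 (symbol_bounded w))).
elim: n => [|n IH]; first by rewrite expr0 scale1r.
by rewrite iterS exprS -scalerA -IH (mul_opP mz_mul).
Qed.

Lemma symbol_multiplier : multiplier (l2 E) H symbol.
Proof.
split=> [w|x]; first exact: symbol_bounded.
by exists (W x); apply/funext => w; exact: dilation_adjoint_fun.
Qed.

Lemma mul_op_symbol : mul_op (l2 E) H symbol = W.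
Proof.
apply/funext => x; apply: (mul_op_unique symbol_multiplier) => w.
exact: dilation_adjoint_fun.
Qed.

(** For every [x] the vector x - dilation (W x) lies in the kernel of [W]. If [x] is orthogonal to
    that kernel, pairing the two gives |x|^2 = |W x|^2. *)
Lemma dilation_adjoint_partial_isometry : partial_isometry W.
Proof.
have bW := adjoint_bounded dilation_bounded.
split=> // x Hx; set u := x - dilation (W x).
have Wu : W u = 0.
  rewrite (linB _ _ (proj1 bW)) dilation_adjointK orthproj_id ?subrr //.
  exact: dilation_adjoint_in.
have := Hx u Wu; rewrite (psdBr (hdot_psd _)) -hdot_adjointl; last first.
  exact: dilation_bounded.
move=> /eqP; rewrite subr_eq0 !hdot_norm => /eqP h.
by apply/eqP; rewrite -(@eqrXn2 _ 2) // h.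
Qed.

Lemma dilation_adjoint_range : S = range W.
Proof.
apply/seteqP; split=> [x Sx|_ [x _ <-]]; last exact: dilation_adjoint_in.
by exists (dilation x) => //; rewrite dilation_adjointK orthproj_id.
Qed.

End Dilation.

Lemma invariant_subspace_range : exists Theta : disc R -> E -> E',
  [/\ multiplier (l2 E) H Theta, partial_isometry (mul_op (l2 E) H Theta)
    & S = range (mul_op (l2 E) H Theta)].
Proof.
have [D [D_lin D_norm]] := psd_represent defect_psd defect_le.
exists (symbol D_norm); rewrite mul_op_symbol //; split.
- exact: symbol_multiplier.
- exact: dilation_adjoint_partial_isometry.
- exact: dilation_adjoint_range.
Qed.

End InvariantSubspace.

(** * The converse: closed ranges of multipliers are invariant *)

Section SzegoKernel.
Variables (R : realType) (H2 : funHilbertType R[i]^o).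
Variable k : disc R -> H2.
Hypothesis k_fun : forall w, fun_of (k w) = (fun z => szego z w).
Hypothesis k_rep : forall w f, fun_of f w = hdot f (k w).

Definition disc0 : disc R :=
  exist _ 0 (eq_trans (congr1 (<%R^~ 1) (normr0 _)) ltr01).

Lemma szego0 (z : disc R) : szego z disc0 = 1.
Proof. by rewrite /szego conjC0 mulr0 subr0 invr1. Qed.

Lemma szego_nz (z w : disc R) : 1 - val z * (val w)^* != 0.
Proof.
rewrite subr_eq0; apply/eqP => /(congr1 Num.norm).
rewrite normr1 normrM norm_conjC => h.
have : `|val z| * `|val w| < 1.
  by rewrite mulr_ilt1 //; [exact: valP z|exact: valP w].
by rewrite -h ltxx.
Qed.

Lemma coord_szego (z w : disc R) : val w != 0 ->
  val z * szego z w = ((val w)^*)^-1 * (szego z w - szego z disc0).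
Proof.
move=> w0; rewrite szego0 /szego; field.
by rewrite szego_nz conjC_eq0 w0.
Qed.

(* The point 0 is excluded because z k_w is known to lie in H2 only for w <>
   0, as (k_w - k_0) / w^*; k_0 is recovered as the limit of k_w. *)
Lemma szego_total (N : set H2) :
  closed_subspace N -> (forall w, val w != 0 -> N (k w)) -> forall f, N f.
Proof.
move=> sN Nk; have qP := hdot_psd H2.
have kk w z : hdot (k w) (k z) = szego z w by rewrite -k_rep k_fun.
have Nk0 : N (k disc0).
  apply: closed_approx => [|e e0]; first by case: sN.
  have e2 : 0 < e / 2 by rewrite divr_gt0.
  have [w [w0 w2 we]] := small_disc e2.
  exists (k w); first exact: Nk.
  (* |k_0 - k_w|^2 = szego w w - 1 = |w|^2 szego w w, and the last factor is at most 4. *)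
  apply: (@le_lt_trans _ _ (2 * `|val w|)); last by rewrite mulrC -ltr_pdivlMr.
  rewrite norm_le_sqr ?mulr_ge0 // -hdot_norm (psdBl qP) !(psdBr qP).
  rewrite !kk !szego0.
  have -> : szego disc0 w = 1 by rewrite /szego mul0r subr0 invr1.
  rewrite subrr sub0r opprB exprMn.
  have -> : szego w w - 1 = `|val w| ^+ 2 * szego w w.
    by rewrite /szego normCK; field; exact: szego_nz.
  by rewrite mulrC ler_wpM2r ?exprn_ge0 // -natrX szego_diag_le.
apply: (closed_subspace_full sN) => f fN; apply: fun_of_inj; apply/funext => w.
rewrite k_rep fN; first by rewrite (lin0 (proj1 (eval_bounded H2 w))).
have [w0|w0] := eqVneq (val w) 0; last exact: Nk.
by rewrite (_ : w = disc0) //; apply: val_inj.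
Qed.

End SzegoKernel.

(** The vectors [g] with T (M g) in the closed range of M form a closed subspace. It is enough to
    treat simple tensors and then, with [eta] fixed, kernel functions in the first factor. *)
Lemma range_invariant (R : realType) (E Estar : hilbertType R)
    (H2 : funHilbertType R[i]^o) (H2E : funHilbertType E)
    (H : funHilbertType Estar) (Theta : disc R -> E -> Estar) :
  is_rkhs (@szego R) H2 -> is_tensor H2 H2E ->
  multiplier H H (@Defs.coord R Estar) -> bounded_linear (@Mz R Estar H) ->
  multiplier H2E H Theta -> bounded_linear (mul_op H2E H Theta) ->
  closed_subspace (range (mul_op H2E H Theta)) ->
  forall f, range (mul_op H2E H Theta) f -> range (mul_op H2E H Theta) (Mz f).
Proof.
move=> /choice[k /all_and2[k_fun k_rep]] [tens [t_fun t_dot t_dense]].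
move=> mz bT mT; set M := mul_op H2E H Theta => bM sS _ [g _ <-].
have t_lin eta : bounded_linear (tens^~ eta).
  split; first exact: (ktens_linearl t_fun).
  by exists `|eta| => f; rewrite (norm_ktens t_dot) mulrC.
have sL : closed_subspace [set g | range M (Mz (M g))].
  exact: closed_subspace_preimage (bounded_linear_comp bM bT) sS.
move: g; apply: (tens_total t_dense) => // f eta.
move: f; apply: (szego_total k_fun k_rep) => [|w w0].
  exact: closed_subspace_preimage (t_lin eta) sL.
exists (((val w)^*)^-1 *: (tens (k w) eta - tens (k (disc0 R)) eta)) => //.
apply/esym; apply: (mul_op_unique mz) => z.
rewrite (linZ _ _ (proj1 bM)) (linB _ _ (proj1 bM)).
have lz := proj1 (eval_bounded H z).
rewrite (linZ _ _ lz) (linB _ _ lz) !mul_opP // !t_fun !k_fun.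
have lT := proj1 (proj1 mT z).
rewrite !(linZ _ _ lT) /Defs.coord -scalerBl !scalerA; congr (_ *: _).
exact/esym/coord_szego.
Qed.

Theorem theorem3p3 (R : realType) (K : disc R -> disc R -> R[i])
    (HK : funHilbertType R[i]^o) (Estar : hilbertType R)
    (HKE : funHilbertType Estar) (S : set HKE) :
  analytic_hilbert K HK ->
  is_tensor HK HKE ->
  closed_subspace S -> S <> [set 0] ->
  ((forall f, S f -> S (Mz f)) <->
   exists (E : hilbertType R) (H2 : funHilbertType R[i]^o)
          (H2E : funHilbertType E) (Theta : disc R -> E -> Estar),
     [/\ is_rkhs (@szego R) H2, is_tensor H2 H2E, multiplier H2E HKE Theta,
         partial_isometry (mul_op H2E HKE Theta)
       & S = range (mul_op H2E HKE Theta)]).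
Proof.
move=> [_ _ _ mA [cA A_C0]] [tens [t_fun t_dot t_dense]] sS _.
have A_mul (f : HK) (w : disc R) : fun_of (Mz f) w = val w * fun_of f w.
  exact: (mul_opP mA).
have mz := tens_multiplier t_fun t_dot t_dense cA A_mul.
have C0 := tens_C_dot0 t_fun t_dot t_dense cA A_mul A_C0.
split=> [S_inv|].
  have [Th [mTh iTh STh]] := invariant_subspace_range mz C0 sS S_inv.
  exists (l2 (complex_hilbert R)), (hardy R), (l2 (l2 (complex_hilbert R))), Th.
  by split=> //; [exact: hardy_szego|exact: hardy_tensor].
case=> E [H2 [H2E [Th [rk te mTh [bTh _] SE]]]].
(* The range inherits its closedness from [S]. *)
rewrite SE in sS *; apply: range_invariant rk te mz _ mTh bTh sS.
by apply: contraction_bounded; case: C0.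
Qed.
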